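(* Let $A\subset\mathbb Z^2$ be a planar circuit, and let $f\in\mathbb C_*^A$. Then $\operatorname{Area}(\mathcal C_f)\le 2\pi^2$.
   Context: A planar circuit is a set $A\subset\mathbb Z^2$ of four points whose convex hull is two-dimensional. $\mathbb C_*=\mathbb C\setminus\{0\}$, and $\mathbb C_*^A$ is the set of polynomials $f(z)=\sum_{\mathbf a\in A}f_{\mathbf a}z^{\mathbf a}$ with all coefficients $f_{\mathbf a}\in\mathbb C_*$. The coamoeba $\mathcal C_f\subset\mathbf T^2=(\mathbb R/2\pi\mathbb Z)^2$ is the image of $\{z\in\mathbb C_*^2:f(z)=0\}$ under $\operatorname{Arg}(z)=(\arg z_1,\arg z_2)$. Area is Lebesgue measure on $\mathbf T^2$ (total area $4\pi^2$), counted without multiplicities. *)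

(* Defs.v *)
From HB Require Import structures.
From mathcomp Require Import all_boot all_order all_algebra finmap.
From mathcomp Require Import all_classical all_reals all_analysis.
From mathcomp Require Import complex.

Set Implicit Arguments.
Unset Strict Implicit.
Unset Printing Implicit Defensive.

Import Order.TTheory GRing.Theory Num.Theory.
Import numFieldNormedType.Exports.

Local Open Scope classical_set_scope.
Local Open Scope ring_scope.

Section PlanarCircuit.
Variable R : realType.

Definition lattice_point (a : int * int) : 'rV[R]_2 :=
  \row_(i < 2) (if i == ord0 then a.1%:~R else a.2%:~R).

Definition conv_hull (A : {fset int * int}) : set 'rV[R]_2 :=
  [set x | exists w : int * int -> R,
     [/\ forall a, a \in A -> 0 <= w a,
         \sum_(a <- A) w a = 1 &
         x = \sum_(a <- A) w a *: lattice_point a]].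

(* The dimension of a convex set is that of its affine hull, i.e. of the
   smallest linear subspace containing all differences of its points. *)
Definition has_affine_dim n (S : set 'rV[R]_n) (d : nat) : Prop :=
  exists V : {vspace 'rV[R]_n},
    [/\ \dim V = d,
        forall x y, S x -> S y -> x - y \in V &
        forall W : {vspace 'rV[R]_n},
          (forall x y, S x -> S y -> x - y \in W) -> (V <= W)%VS].

Definition planar_circuit (A : {fset int * int}) : Prop :=
  #|` A|%fset = 4%N /\ has_affine_dim (conv_hull A) 2.

End PlanarCircuit.

Section Coamoeba.
Variable R : realType.

(* Laurent polynomials in two variables, as finitely supported families of
   coefficients indexed by exponent vectors. *)
Definition laurent2 : Type := {fsfun int * int -> R[i] with 0}.

Definition laurent_eval (f : laurent2) (z : R[i] * R[i]) : R[i] :=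
  \sum_(a <- finsupp f) f a * (z.1 ^ a.1 * z.2 ^ a.2).

(* The argument of z <> 0, with values in the fundamental domain [0, 2 pi[ of
   R / 2 pi Z; see argP. *)
Definition arg (z : R[i]) : R :=
  let t := acos (complex.Re z / Normc.normc z) in
  if 0 <= complex.Im z then t else 2 * pi - t.

Definition Arg (z : R[i] * R[i]) : R * R := (arg z.1, arg z.2).

(* The torus (R / 2 pi Z)^2 is represented by [0, 2 pi[^2. *)
Definition coamoeba (f : laurent2) : set (R * R) :=
  Arg @` [set z | [/\ z.1 != 0, z.2 != 0 & laurent_eval f z = 0]].

(* Lebesgue measure on R^2; on subsets of [0, 2 pi[^2 it is the measure of
   total mass 4 pi^2 on the torus. *)
Definition area (S : set (R * R)) : \bar R :=
  ((@lebesgue_measure R) \x (@lebesgue_measure R))%E S.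

Lemma argP (z : R[i]) : z != 0 ->
  0 <= arg z < 2 * pi /\
  z = Complex (Normc.normc z * cos (arg z)) (Normc.normc z * sin (arg z)).
Proof.
case: z => x y z0; rewrite /arg /=.
set r := Num.sqrt (x ^+ 2 + y ^+ 2).
have s0 : 0 < x ^+ 2 + y ^+ 2.
  rewrite lt_neqAle addr_ge0 ?sqr_ge0// andbT eq_sym paddr_eq0 ?sqr_ge0//.
  by rewrite !sqrf_eq0; apply: contra z0 => /andP[/eqP-> /eqP->].
have r0 : 0 < r by rewrite sqrtr_gt0.
have rn0 : r != 0 by rewrite gt_eqF.
have r2 : r ^+ 2 = x ^+ 2 + y ^+ 2 by rewrite sqr_sqrtr// ltW.
have c1 : -1 <= x / r <= 1.
  rewrite -ler_norml normrM normfV (gtr0_norm r0) ler_pdivrMr// mul1r.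
  by rewrite -sqrtr_sqr ler_sqrt ?lerDl ?sqr_ge0// ltW.
have ca : cos (acos (x / r)) = x / r by apply: acosK; rewrite in_itv.
have sa : r * sin (acos (x / r)) = `|y|.
  rewrite sin_acos//; have -> : 1 - (x / r) ^+ 2 = (y / r) ^+ 2.
    by apply/eqP; rewrite !expr_div_n r2 subr_eq -mulrDl [y ^+ 2 + _]addrC divff// gt_eqF.
  by rewrite sqrtr_sqr normrM normfV (gtr0_norm r0) mulrCA divff// mulr1.
have xE : r * (x / r) = x by rewrite mulrCA divff// mulr1.
case: ifPn => [y0|]; last rewrite -ltNge => y0.
  rewrite acos_ge0//= (le_lt_trans (acos_lepi c1)) ?ltr_pMl ?pi_gt0 ?ltr1n//.
  by rewrite ca sa xE ger0_norm.
have c1' : -1 <= x / r < 1.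
  case/andP: (c1) => -> /= le1; rewrite lt_neqAle le1 andbT.
  apply/eqP => e1; have xr : x = r by rewrite -xE e1 mulr1.
  by move: r2; rewrite -xr => /eqP; rewrite -subr_eq0 opprD addNKr
    oppr_eq0 sqrf_eq0 lt_eqF.
split.
  rewrite ltrBlDr ltrDl acos_gt0// andbT subr_ge0.
  by rewrite (le_trans (acos_lepi c1))// ler_pMl ?pi_gt0 ?ler1n.
have -> : 2 * pi - acos (x / r) = - acos (x / r) + pi *+ 2.
  by rewrite addrC mulr_natl.
by rewrite cosD2pi sinD2pi cosN sinN ca xE mulrN sa ltr0_norm// opprK.
Qed.

End Coamoeba.

(* Main.v *)
(* Write phi_k for the argument of the k-th monomial at a point theta of the torus.
   If theta is in the coamoeba, then 0 is a positive combination of the four unit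
   vectors e^(i phi_k), and for generic theta it then lies inside exactly two of the
   four triangles that they form. A triangle whose exponents are not collinear
   contains 0 on a set of area at most pi^2: translating theta by half-periods
   flips two of its vertices independently, and the four translates are disjoint.
   Without three collinear exponents this gives 2 Area <= 4 pi^2.

   Now let n a_1 = (n - p) a_0 + p a_2 with 0 < p < n coprime. The moduli r_k of the
   monomials satisfy r_0^(n-p) r_2^p = kappa r_1^n with kappa constant, which excludes
   part of the overlap of the triangles 012 and 023, or of its image under the flip
   of e^(i phi_3), according to the sign of |s_12|^(n-p) |s_01|^p - kappa |s_02|^n,
   where s_jk = sin(phi_k - phi_j). Counting again, 2 Area <= 3 pi^2 + Area(X), where
   X is the set where 0 is in triangle 012 and the line of e^(i phi_3) does not meet
   the sector spanned by the vertices 0 and 2. Finally Area(X) <= pi^2 by averaging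
   over the rotations of vertex 1 by multiples of 2 pi / n. *)
Require Import Defs.
From mathcomp Require Import all_boot all_order all_algebra finmap.
From mathcomp Require Import all_classical all_reals all_analysis.
From mathcomp Require Import complex.
From mathcomp Require Import measurable_realfun ring lra zify.

Set Implicit Arguments.
Unset Strict Implicit.
Unset Printing Implicit Defensive.

Import Order.TTheory GRing.Theory Num.Theory.
Import numFieldNormedType.Exports.

Local Open Scope classical_set_scope.
Local Open Scope ring_scope.

(** * Area on the torus *)

Section TorusArea.
Context {R : realType}.
Notation T := (2 * @pi R).
Notation lam := (@lebesgue_measure R).
Notation lam2 := (product_measure1 lam lam).

Lemma lebesgue_measure_shift (v : R) (A : set R) : measurable A ->
  lam [set x | A (x + v)] = lam A.
Proof.
move=> mA.
have mf : measurable_fun setT (fun x : R => x + v).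
  by apply: measurable_funD => //; exact: measurable_cst.
apply/esym.
apply: (@lebesgue_measure_unique R (pushforward lam (fun x : measurableTypeR R => x + v :
  measurableTypeR R))) => //.
move=> X [[a b] _ <-].
rewrite /= /pushforward.
rewrite [X in _ = lam X](_ : _ = [set` Interval (BRight (a - v)) (BRight (b - v))]).
  rewrite !lebesgue_measure_itv/= !lte_fin ltrD2r.
  by case: ifP => // _; rewrite -!EFinB; congr (_%:E); ring.
by apply/seteqP; split => x /=; rewrite !in_itv/= ltrBlDr lerBrDr.
Qed.

(** After reducing [v] modulo the period, the windows [[v, T + v[] and [[0, T[] share [[v, T[], and
    the leftover pieces differ by one full period. *)
Lemma circle_shift (v : R) (P : set R) : measurable P ->
  (forall x, P (x + T) <-> P x) ->
  lam ([set` `[0, T[] `&` [set x | P (x + v)]) = lam ([set` `[0, T[] `&` P).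
Proof.
move=> mP perP.
have T0 : 0 < T by rewrite mulr_gt0// pi_gt0.
have perPn (n : nat) x : P (x + T *+ n) <-> P x.
  elim: n x => [|n IH] x; first by rewrite mulr0n addr0.
  by rewrite mulrSr addrA perP.
have perPz (z : int) x : P (x + T *~ z) <-> P x.
  case: z => n; first exact: perPn.
  by rewrite NegzE mulrNz -(perPn n.+1) -pmulrn subrK.
wlog v0 : v / 0 <= v < T.
  move=> H; pose z := Num.floor (v / T).
  have vz : 0 <= v - T *~ z < T.
    have /andP[] : z%:~R <= v / T < (z + 1)%:~R by exact: floor_itv.
    rewrite -mulrzr intrD ler_pdivlMr// ltr_pdivrMr// => h1 h2.
    by apply/andP; split; lra.
  rewrite -(H _ vz); congr (lam (_ `&` _)); apply/seteqP; split => x /= Px.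
    by rewrite addrA -mulrNz perPz.
  by rewrite -(perPz (- z)) mulrNz -addrA.
have {}mI (i : interval R) : measurable [set` i] by exact: measurable_itv.
have mPI (i : interval R) : measurable ([set` i] `&` P) by exact: measurableI.
have mv (w : R) A : measurable A -> measurable [set x : R | A (x + w)].
  move=> mA; rewrite -[X in measurable X]setTI.
  have mf : measurable_fun setT (fun x : R => x + w).
    by apply: measurable_funD => //; exact: measurable_cst.
  exact: mf.
case/andP : v0 => v0 vT.
transitivity (lam ([set` `[v, T + v[] `&` P)).
  rewrite -(@lebesgue_measure_shift v ([set` `[v, T + v[] `&` P)) //; congr (lam _).
  by apply/seteqP; split => x /=; rewrite !in_itv/= lerDr ltrD2r.
rewrite (_ : [set` `[v, T + v[] `&` P =
  ([set` `[v, T[] `&` P) `|` ([set` `[T, T + v[] `&` P)); last first.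
  apply/seteqP; split => x /=; rewrite !in_itv/=.
    case=> /andP[h1 h2] Px; have [xT|xT] := ltP x T; [left|right]; split => //; lra.
  by case=> -[/andP[h1 h2] Px]; split => //; lra.
rewrite (_ : [set` `[0, T[] `&` P = ([set` `[v, T[] `&` P) `|` ([set` `[0, v[] `&` P));
  last first.
  apply/seteqP; split => x /=; rewrite !in_itv/=.
    case=> /andP[h1 h2] Px; have [xT|xT] := ltP x v; [right|left]; split => //; lra.
  by case=> -[/andP[h1 h2] Px]; split => //; lra.
have dis a b c d : b <= c -> ([set` `[a, b[] `&` P) `&` ([set` `[c, d[] `&` P) = set0.
  move=> bc; rewrite -subset0 => x /= [] []; rewrite !in_itv/= => + _ [+ _]; lra.
rewrite measureU//; [|exact: mPI|exact: mPI|exact: dis].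
rewrite measureU//; [|exact: mPI|exact: mPI|by rewrite setIC; exact: dis].
congr (_ + _)%E.
apply: etrans (esym (@lebesgue_measure_shift T ([set` `[T, T + v[] `&` P) (mPI _))) _.
congr (lam _).
apply/seteqP; split => x /=; rewrite !in_itv/=.
  by case=> h /perP; split => //; lra.
by case=> h /perP; split => //; lra.
Qed.

Definition square : set (R * R) := [set` `[0, T[] `*` [set` `[0, T[].

Lemma measurable_square : measurable square.
Proof. by apply: measurableX; exact: measurable_itv. Qed.

Lemma product_measure12 A : measurable A -> lam2 A = product_measure2 lam lam A.
Proof. by apply: product_measure_unique => *; exact: product_measure2E. Qed.

Lemma pairD (x y : R * R) : x + y = (x.1 + y.1, x.2 + y.2).
Proof. by []. Qed.

Lemma measurable_add_pair (v : R * R) : measurable_fun [set: R * R] (fun x => x + v).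
Proof.
rewrite (_ : (fun x : R * R => _) = (fun x => (x.1 + v.1, x.2 + v.2))).
  by apply: measurable_fun_pair; apply: measurable_funD; first
    [exact: measurable_fst|exact: measurable_snd|exact: measurable_cst].
by apply/funext => -[].
Qed.

(** A translation splits into a vertical and a horizontal one. Each reduces to [circle_shift] on
    sections, the horizontal one after exchanging the order of integration. *)
Lemma torus_shift (v : R * R) (P : set (R * R)) : measurable P ->
  (forall x y, P (x + T, y) <-> P (x, y)) -> (forall x y, P (x, y + T) <-> P (x, y)) ->
  lam2 (square `&` [set x | P (x + v)]) = lam2 (square `&` P).
Proof.
move=> mP perx pery; case: v => v1 v2.
have msh (w : R * R) A : measurable A -> measurable [set x : R * R | A (x + w)].
  move=> mA; rewrite -[X in measurable X]setTI.
  exact: measurable_add_pair.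
have vert (w : R) (A : set (R * R)) : measurable A ->
    (forall x y, A (x, y + T) <-> A (x, y)) ->
  lam2 (square `&` [set x | A (x + (0 : R, w))]) = lam2 (square `&` A).
  move=> mA perA; apply: eq_integral => x _ /=.
  have [xI|xI] := boolP (x \in `[0, T[).
    have E B : xsection (square `&` B) x = [set` `[0, T[] `&` xsection B x.
      rewrite xsectionE; apply/seteqP; split => y /=.
        by move=> [[_ +] By]; split => //; rewrite xsectionE.
      by rewrite xsectionE => -[h By].
    rewrite !E -(@circle_shift w (xsection A x)) //; last 2 first.
    - exact: measurable_xsection.
    - by move=> y; rewrite xsectionE /= perA.
    congr (lam (_ `&` _)); rewrite !xsectionE; apply/seteqP.
    by split => y /=; rewrite pairD /= addr0.
  suff E B : xsection (square `&` B) x = set0 by rewrite !E.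
  by rewrite -subset0 xsectionE => y [[/= h]]; rewrite h in xI.
have hor (w : R) (A : set (R * R)) : measurable A ->
    (forall x y, A (x + T, y) <-> A (x, y)) ->
  lam2 (square `&` [set x | A (x + (w, 0 : R))]) = lam2 (square `&` A).
  move=> mA perA.
  have mS : measurable (square `&` A) by apply: measurableI => //; exact: measurable_square.
  have mS' : measurable (square `&` [set x | A (x + (w, 0 : R))]).
    by apply: measurableI; [exact: measurable_square|exact: msh].
  rewrite !product_measure12 //.
  apply: eq_integral => y _ /=.
  have [yI|yI] := boolP (y \in `[0, T[).
    have E B : ysection (square `&` B) y = [set` `[0, T[] `&` ysection B y.
      rewrite ysectionE; apply/seteqP; split => x /=.
        by move=> [[+ _] By]; split => //; rewrite ysectionE.
      by rewrite ysectionE => -[h By].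
    rewrite !E -(@circle_shift w (ysection A y)) //; last 2 first.
    - exact: measurable_ysection.
    - by move=> x; rewrite ysectionE /= perA.
    congr (lam (_ `&` _)); rewrite !ysectionE; apply/seteqP.
    by split => x /=; rewrite pairD /= addr0.
  suff E B : ysection (square `&` B) y = set0 by rewrite !E.
  by rewrite -subset0 ysectionE => x [[/= _ h]]; rewrite h in yI.
apply: etrans (vert v2 _ mP pery).
apply: etrans (hor v1 [set x | P (x + (0 : R, v2))] (msh _ _ mP) _).
  congr (lam2 (_ `&` _)); apply/seteqP; split => -[x y] /=;
  by rewrite !pairD /= !(addr0, add0r).
by move=> x y /=; rewrite !pairD /= !addr0 perx.
Qed.
End TorusArea.

(** * Periodic measurable functions and areas of torus regions *)

Section TorusFunctions.
Context {R : realType}.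
Notation T := (2 * @pi R).
Notation lam := (@lebesgue_measure R).
Notation lam2 := (product_measure1 lam lam).

(** Measurable functions on the plane that descend to the torus; the boolean ones stand for the
    regions whose area is measured. *)
Definition torus_fun d (U : measurableType d) (F : R * R -> U) : Prop :=
  measurable_fun setT F /\
  forall x y, F (x + T, y) = F (x, y) /\ F (x, y + T) = F (x, y).

Lemma torus_fun_cst d (U : measurableType d) (c : U) : torus_fun (fun=> c).
Proof. by split=> //; exact: measurable_cst. Qed.

Lemma torus_fun_comp2 d1 d2 d (U1 : measurableType d1) (U2 : measurableType d2)
    (U : measurableType d) (op : U1 -> U2 -> U) F G :
  (forall F G, measurable_fun setT F -> measurable_fun setT G ->
     measurable_fun [set: R * R] (fun x => op (F x) (G x))) ->
  torus_fun F -> torus_fun G -> torus_fun (fun x => op (F x) (G x)).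
Proof.
move=> mop [mF pF] [mG pG]; split; first exact: mop.
by move=> x y; have [-> ->] := pF x y; have [-> ->] := pG x y.
Qed.

Lemma torus_fun_and (b c : R * R -> bool) :
  torus_fun b -> torus_fun c -> torus_fun (fun x => b x && c x).
Proof. by apply: torus_fun_comp2 => *; exact: measurable_and. Qed.

Lemma torus_fun_or (b c : R * R -> bool) :
  torus_fun b -> torus_fun c -> torus_fun (fun x => b x || c x).
Proof. by apply: torus_fun_comp2 => *; exact: measurable_or. Qed.

Lemma torus_fun_comp d1 d (U1 : measurableType d1) (U : measurableType d)
    (op : U1 -> U) F :
  measurable_fun setT op -> torus_fun F -> torus_fun (fun x => op (F x)).
Proof.
move=> mop [mF pF]; split; first exact: measurableT_comp.
by move=> x y; have [-> ->] := pF x y.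
Qed.

Lemma torus_fun_neg (b : R * R -> bool) :
  torus_fun b -> torus_fun (fun x => ~~ b x).
Proof. by apply: torus_fun_comp; exact: measurable_neg. Qed.

Lemma torus_fun_lt (F G : R * R -> R) :
  torus_fun F -> torus_fun G -> torus_fun (fun x => F x < G x).
Proof. by apply: torus_fun_comp2 => *; exact: measurable_fun_ltr. Qed.

Lemma torus_fun_mul (F G : R * R -> R) :
  torus_fun F -> torus_fun G -> torus_fun (fun x => F x * G x).
Proof. by apply: torus_fun_comp2 => *; exact: measurable_funM. Qed.

Lemma torus_fun_exp (F : R * R -> R) n :
  torus_fun F -> torus_fun (fun x => F x ^+ n).
Proof.
have mX : measurable_fun setT (fun u : R => u ^+ n) by exact: measurable_funX.
by move=> tF; exact: (torus_fun_comp mX tF).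
Qed.

Lemma torus_fun_norm (F : R * R -> R) :
  torus_fun F -> torus_fun (fun x => `|F x|).
Proof. by move=> tF; exact: (torus_fun_comp (@normr_measurable R setT) tF). Qed.

Lemma torus_fun_eq0 (F : R * R -> R) :
  torus_fun F -> torus_fun (fun x => F x == 0).
Proof.
have m0 : measurable_fun setT (fun u : R => u == 0).
  by apply: measurable_fun_eqr => //; exact: measurable_cst.
by move=> tF; exact: (torus_fun_comp m0 tF).
Qed.

Lemma torus_fun_shift d (U : measurableType d) (F : R * R -> U) v :
  torus_fun F -> torus_fun (fun x => F (x + v)).
Proof.
move=> [mF pF]; split.
  by apply: measurableT_comp => //; exact: measurable_add_pair.
move=> x y; rewrite !pairD /= !(addrAC _ T).
by have [-> ->] := pF (x + v.1) (y + v.2).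
Qed.

(** A real lift of the argument of a monomial. It is periodic only modulo [2 * pi], so regions are
    cut out by sines and cosines of differences. *)
Definition phase (al : R) (a : int * int) (x : R * R) : R :=
  al + (a.1%:~R * x.1 + a.2%:~R * x.2).

Definition pairing (a : int * int) (v : R * R) : R := a.1%:~R * v.1 + a.2%:~R * v.2.

Lemma phaseD al a x v : phase al a (x + v) = phase al a x + pairing a v.
Proof. by rewrite /phase /pairing /=; ring. Qed.

Lemma sin_period (z : int) (u : R) : sin (u + z%:~R * T) = sin u.
Proof.
have H (n : nat) w : sin (w + n%:R * T) = sin w.
  elim: n w => [|n IH] w; first by rewrite mul0r addr0.
  by rewrite -[RHS](IH w) -[RHS]sinD2pi; congr sin; rewrite -(natr1 n) mulr2n; ring.
by case: z => n; [exact: H|rewrite NegzE -(H n.+1); congr sin; rewrite mulrNz; ring].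
Qed.

Lemma torus_fun_sin al a be b : torus_fun (fun x => sin (phase be b x - phase al a x)).
Proof.
split.
  apply: measurableT_comp; first exact: continuous_measurable_fun (@continuous_sin R).
  rewrite /phase; apply: measurable_funB; apply: measurable_funD;
  first [exact: measurable_cst | apply: measurable_funD]; apply: measurable_funM;
  first [exact: measurable_cst | exact: measurable_fst | exact: measurable_snd].
move=> x y; rewrite /phase /=; split.
  by rewrite -[RHS](sin_period (b.1 - a.1)) intrD mulrNz; congr sin; ring.
by rewrite -[RHS](sin_period (b.2 - a.2)) intrD mulrNz; congr sin; ring.
Qed.

Lemma torus_fun_cos al a be b : torus_fun (fun x => cos (phase be b x - phase al a x)).
Proof.
rewrite (_ : (fun x => _) = fun x => sin (phase (be + pi / 2) b x - phase al a x)).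
  exact: torus_fun_sin.
by apply/funext => x; rewrite -sinDpihalf; congr sin; rewrite /phase; ring.
Qed.

Definition torus_area (b : R * R -> bool) : R := fine (lam2 (square `&` [set x | b x])).

Lemma torus_fun_measurable (b : R * R -> bool) : torus_fun b ->
  measurable [set x | b x].
Proof.
move=> [mb _]; rewrite -[X in measurable X]setTI.
by have := mb measurableT [set true]; apply.
Qed.

Lemma lam2_square : lam2 square = (4 * pi ^+ 2)%:E.
Proof.
have E : lam [set` `[0, T[] = T%:E.
  rewrite lebesgue_measure_itv/= lte_fin mulr_gt0 ?pi_gt0//.
  by rewrite -EFinB subr0.
transitivity ((lam [set` `[0%R, T[%R] : \bar R) * lam [set` `[0%R, T[%R])%E.
  by apply: product_measure1E; exact: measurable_itv.
by rewrite E -EFinM; congr (_%:E); ring.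
Qed.

Lemma torus_areaE (b : R * R -> bool) : torus_fun b ->
  lam2 (square `&` [set x | b x]) = (torus_area b)%:E.
Proof.
move=> /torus_fun_measurable mb; rewrite /torus_area fineK//.
rewrite ge0_fin_numE ?measure_ge0//.
apply: (@le_lt_trans _ _ (lam2 square)); last by rewrite lam2_square ltry.
by apply: le_measure; rewrite ?inE; [apply: measurableI|..];
  rewrite //; exact: measurable_square.
Qed.

Lemma torus_area_ge0 b : 0 <= torus_area b.
Proof. exact: fine_ge0. Qed.

Lemma torus_area_true : torus_area (fun=> true) = 4 * pi ^+ 2.
Proof.
rewrite /torus_area (_ : [set x | true] = setT) ?setIT ?lam2_square//.
by apply/seteqP; split.
Qed.

Lemma torus_area_shift (v : R * R) (b : R * R -> bool) : torus_fun b ->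
  torus_area (fun x => b (x + v)) = torus_area b.
Proof.
move=> tb; congr fine; apply: (@torus_shift _ v [set x | b x]).
- exact: torus_fun_measurable.
- by case: tb => _ pb x y /=; rewrite (pb x y).1.
- by case: tb => _ pb x y /=; rewrite (pb x y).2.
Qed.

(** Integrates a pointwise comparison of the numbers of regions containing [x]; a region repeated in
    a list counts with multiplicity. *)
Lemma torus_area_count (I J : seq (R * R -> bool)) :
  (forall b, List.In b I -> torus_fun b) -> (forall b, List.In b J -> torus_fun b) ->
  (forall x, (\sum_(b <- I) b x <= \sum_(b <- J) b x)%N) ->
  \sum_(b <- I) torus_area b <= \sum_(b <- J) torus_area b.
Proof.
have key (K : seq (R * R -> bool)) : (forall b, List.In b K -> torus_fun b) ->
  measurable_fun square (fun x => ((\sum_(b <- K) b x)%N%:R : R)%:E) /\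
  (\int[lam2]_(x in square) ((\sum_(b <- K) b x)%N%:R : R)%:E)%E = (\sum_(b <- K)
    torus_area b)%:E.
  elim: K => [_|b K IH tK].
    rewrite (_ : (fun x => _) = cst 0%E); last by apply/funext => x; rewrite big_nil.
    by rewrite big_nil integral0; split => //; exact: measurable_cst.
  have tb : torus_fun b by apply: tK; left.
  have mb := torus_fun_measurable tb.
  have [mK iK] := IH (fun c cK => tK c (or_intror cK)).
  rewrite (_ : (fun x => _) = (fun x => (\1_[set x | b x] x)%:E + ((\sum_(c <- K) c x)%N%:R
    : R)%:E)%E); last first.
    apply/funext => x; rewrite big_cons natrD EFinD; congr (_ + _)%E; rewrite indicE;
      congr ((_ : bool)%:R%:E).
    by apply/idP/idP; rewrite inE.
  have m1 : measurable_fun square (fun x => (\1_[set x | b x] x : R)%:E).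
    by apply/measurable_EFinP; exact: measurable_indic.
  split; first exact: emeasurable_funD.
  rewrite ge0_integralD//; last exact: measurable_square.
  rewrite iK integral_indic//; last exact: measurable_square.
  by rewrite setIC big_cons EFinD; congr (_ + _)%E; exact: torus_areaE.
move=> /key[mI iI] /key[mJ iJ] le.
rewrite -lee_fin -iI -iJ; apply: ge0_le_integral => //.
- exact: measurable_square.
- by move=> x _; rewrite lee_fin ler_nat.
Qed.
End TorusFunctions.

(** Twice the signed area of the triangle, zero exactly when the points are collinear. *)
Definition cross (x y z : int * int) : int :=
  (y.1 - x.1) * (z.2 - x.2) - (y.2 - x.2) * (z.1 - x.1).

(** * Comparing areas by counting regions and translates *)

Section Counting.
Context {R : realType}.
Implicit Types b c : R * R -> bool.

(** Appending to [J] one copy of the null region [b0] per entry of [I] makes the comparison hold on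
    [b0] too and leaves the total area unchanged. *)
Lemma torus_area_count_ae b0 (I J : seq (R * R -> bool)) :
  torus_fun b0 -> torus_area b0 = 0 ->
  (forall b, List.In b I -> torus_fun b) -> (forall b, List.In b J -> torus_fun b) ->
  (forall x, ~~ b0 x -> (\sum_(b <- I) b x <= \sum_(b <- J) b x)%N) ->
  \sum_(b <- I) torus_area b <= \sum_(b <- J) torus_area b.
Proof.
move=> t0 mu0 tI tJ le.
have -> : \sum_(b <- J) torus_area b = \sum_(b <- J ++ nseq (size I) b0) torus_area b.
  by rewrite big_cat /= big_nseq iter_addr mu0 mul0rn !addr0.
apply: torus_area_count => //.
  move=> b; elim: J tJ {le} => [_|c J IH tJ] /=.
    by elim: (size I) => //= n IH [<-|].
  move=> [<-|]; first by apply: tJ; left.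
  by apply: IH => c' h; apply: tJ; right.
move=> x; rewrite big_cat /= big_nseq iter_addn_0.
have [xb|xb] := boolP (b0 x); last first.
  by rewrite (leq_trans (le _ xb))// leq_addr.
rewrite mul1n (leq_trans _ (leq_addl _ _))//.
by elim: (I) => [|c K IH]; rewrite ?big_nil// big_cons /= -add1n leq_add// leq_b1.
Qed.

Lemma torus_area_translates b (m : nat) (v : nat -> R * R) (J : seq (R * R -> bool)) :
  torus_fun b -> (forall c, List.In c J -> torus_fun c) ->
  (forall x, (\sum_(j < m) b (x + v j)%R <= \sum_(c <- J) c x)%N) ->
  m%:R * torus_area b <= \sum_(c <- J) torus_area c.
Proof.
move=> tb tJ le.
have -> : m%:R * torus_area b = \sum_(f <- [seq (fun x => b (x + v j)) | j <- iota 0 m])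
  torus_area f.
  rewrite big_map (eq_bigr (fun=> torus_area b)); last by move=> j _;
    exact: torus_area_shift.
  by rewrite big_const_seq count_predT size_iota iter_addr addr0 mulr_natl.
apply: torus_area_count => //.
  move=> f; elim: (iota 0 m) => //= j s IH [<-|//]; exact: torus_fun_shift.
move=> x; rewrite big_map.
by move: (le x); rewrite -(big_mkord xpredT (fun j => b (x + v j) : nat)) /index_iota subn0.
Qed.

Lemma torus_area_translates_le b c (m : nat) (v : nat -> R * R) :
  torus_fun b -> torus_fun c ->
  (forall x, (\sum_(j < m) b (x + v j)%R <= c x)%N) ->
  m%:R * torus_area b <= torus_area c.
Proof.
move=> tb tc le; have -> : torus_area c = \sum_(d <- [:: c]) torus_area d by rewrite
  big_seq1.
apply: torus_area_translates tb _ _ => [d [<-//|//]|x]; rewrite big_seq1; exact: le.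
Qed.

Lemma sum_bool_le1 (m : nat) (f : nat -> bool) :
  (forall i j, (i < j < m)%N -> f i -> ~~ f j) -> (\sum_(i < m) f i <= 1)%N.
Proof.
elim: m => [|m IH] H; first by rewrite big_ord0.
rewrite big_ord_recr /=; have [fm|fm] := boolP (f m); last first.
  by rewrite addn0 IH// => i j /andP[ij jm]; apply: H; rewrite ij ltnW.
rewrite big1 // => i _; apply/eqP; rewrite eqb0; apply/negP => fi.
by have := H i m; rewrite ltn_ord leqnn fm => /(_ isT fi).
Qed.

End Counting.

(** * Phase differences and the triangles spanned by the phases *)

Section Phases.
Context {R : realType}.
Variables (al : nat -> R) (a : nat -> int * int).

Definition phase_diff i j (x : R * R) : R := phase (al j) (a j) x - phase (al i) (a i) x.

Definition sin_diff i j (x : R * R) : R := sin (phase_diff i j x).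

Lemma phase_diff_shift i j x v :
  phase_diff i j (x + v) = phase_diff i j x + (pairing (a j) v - pairing (a i) v).
Proof. by rewrite /phase_diff !phaseD; ring. Qed.

Lemma phase_diffN i j x : phase_diff j i x = - phase_diff i j x.
Proof. by rewrite /phase_diff opprB. Qed.

Lemma phase_diffD i j k x : phase_diff i k x = phase_diff i j x + phase_diff j k x.
Proof. by rewrite /phase_diff; ring. Qed.

Lemma sin_diffC i j x : sin_diff j i x = - sin_diff i j x.
Proof. by rewrite /sin_diff phase_diffN sinN. Qed.

Lemma torus_fun_sin_diff i j : torus_fun (sin_diff i j).
Proof. exact: torus_fun_sin. Qed.

(* Rotating the phase difference by the multiples of pi / m below pi gives m
   disjoint translates, for every m. *)
Lemma sin_diff_null i j : a i != a j -> torus_area (fun x => sin_diff i j x == 0) = 0.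
Proof.
move=> ij.
(* [w] moves along a coordinate in which the exponents differ, scaled so that the phase difference
   grows at unit rate. *)
have [w Hw] : exists w : R * R, pairing (a j) w - pairing (a i) w = 1.
  rewrite /pairing; move: ij; case: (a i) (a j) => [p q] [p' q'] /=.
  have [->|pp _] := eqVneq p p'.
    rewrite xpair_eqE eqxx /= => qq; exists (0, (q' - q)%:~R^-1) => /=.
    by rewrite !mulr0 !add0r -mulrBl -intrB mulfV// intr_eq0 subr_eq0 eq_sym.
  exists ((p' - p)%:~R^-1, 0) => /=.
  by rewrite !mulr0 !addr0 -mulrBl -intrB mulfV// intr_eq0 subr_eq0 eq_sym.
have key m : m%:R * torus_area (fun x => sin_diff i j x == 0) <= 4 * pi ^+ 2.
  rewrite -torus_area_true.
  pose v (l : nat) := (pi * l%:R / m%:R * w.1, pi * l%:R / m%:R * w.2) : R * R.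
  apply: (@torus_area_translates_le _ _ (fun=> true) m v).
  - by apply: torus_fun_eq0; exact: (torus_fun_sin_diff i j).
  - exact: torus_fun_cst.
  - move=> x; apply: (@sum_bool_le1 m (fun l => sin_diff i j (x + v l) == 0)) => l l'
    /andP[ll' l'm].
    set u := phase_diff i j x.
    have E l0 : sin_diff i j (x + v l0) = sin (u + pi * l0%:R / m%:R).
      rewrite /sin_diff phase_diff_shift -/u; congr (sin (u + _)).
      transitivity (pi * l0%:R / m%:R * (pairing (a j) w - pairing (a i) w)).
        by rewrite /pairing /=; ring.
      by rewrite Hw mulr1.
    rewrite !E => /eqP s0; apply/eqP => s1.
    have m0 : (0 < m%:R :> R) by rewrite ltr0n; lia.
    have : sin (pi * (l' - l)%:R / m%:R : R) = 0.
      have -> : pi * (l' - l)%:R / m%:R = (u + pi * l'%:R / m%:R) - (u + pi * l%:R / m%:R)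
        :> R.
        by rewrite natrB 1?ltnW//; ring.
      by rewrite sinB s0 s1; ring.
    apply/eqP; rewrite gt_eqF// sin_gt0_pi//.
    rewrite divr_gt0 ?mulr_gt0 ?pi_gt0 ?ltr0n ?subn_gt0//=; last by rewrite -(ltr0n R).
    by rewrite ltr_pdivrMr// ltr_pM2l ?pi_gt0// ltr_nat; lia.
(* A positive area would violate [key] for large [m]. *)
apply: le_anti; rewrite torus_area_ge0 andbT leNgt; apply/negP => mu0.
have /= := key (Num.truncn (4 * pi ^+ 2 / torus_area (fun x => sin_diff i j x == 0))).+1.
by rewrite leNgt -ltr_pdivrMr// truncnS_gt.
Qed.

Notation det i j k := (cross (a i) (a j) (a k)).

(** Cramer's rule: noncollinear exponents allow two phase differences to be moved independently. *)
Lemma exists_shift i j k (be ga : R) : det i j k != 0 ->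
  exists v : R * R, pairing (a j) v - pairing (a i) v = be /\
                    pairing (a k) v - pairing (a i) v = ga.
Proof.
rewrite -(intr_eq0 R) /cross !(rmorphB, rmorphM) /=.
rewrite /pairing; move: (a i) (a j) (a k) => [x y] [x1 y1] [x2 y2] /= D0.
set D := (X in X != 0) in D0.
exists ((be * (y2%:~R - y%:~R) - ga * (y1%:~R - y%:~R)) / D,
  (ga * (x1%:~R - x%:~R) - be * (x2%:~R - x%:~R)) / D) => /=.
by rewrite /D in D0 *; split; field.
Qed.

(** The origin is interior to the triangle of three unit vectors when the turns from each to the
    next are all less than half a circle in a common direction. *)
Definition in_triangle i j k (x : R * R) : bool :=
  [&& 0 < sin_diff i j x, 0 < sin_diff j k x & 0 < sin_diff k i x] ||
  [&& sin_diff i j x < 0, sin_diff j k x < 0 & sin_diff k i x < 0].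

Lemma torus_fun_sin_diff_gt0 i j : torus_fun (fun x => 0 < sin_diff i j x).
Proof. by apply: torus_fun_lt; [exact: torus_fun_cst|exact: torus_fun_sin_diff]. Qed.

Lemma torus_fun_sin_diff_lt0 i j : torus_fun (fun x => sin_diff i j x < 0).
Proof. by apply: torus_fun_lt; [exact: torus_fun_sin_diff|exact: torus_fun_cst]. Qed.

Lemma torus_fun_in_triangle i j k : torus_fun (in_triangle i j k).
Proof.
by apply: torus_fun_or; repeat first
  [exact: torus_fun_sin_diff_gt0|exact: torus_fun_sin_diff_lt0|apply: torus_fun_and].
Qed.

Lemma sinBpi (u : R) : sin (u - pi) = - sin u.
Proof. by rewrite -[in RHS](subrK pi u) sinDpi opprK. Qed.

(* The four translates flipping the phases j and k independently are disjoint. *)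
Lemma torus_area_in_triangle i j k : det i j k != 0 -> torus_area (in_triangle i j k) <= pi
  ^+ 2.
Proof.
move=> d0.
have [v1 [j1 k1]] := exists_shift pi 0 d0.
have [v2 [j2 k2]] := exists_shift 0 pi d0.
have [v3 [j3 k3]] := exists_shift pi pi d0.
suff : 4%:R * torus_area (in_triangle i j k) <= torus_area (fun=> true : bool) by rewrite
  torus_area_true; lra.
apply: (@torus_area_translates_le _ _ _ _ (nth 0 [:: 0; v1; v2; v3])).
- exact: torus_fun_in_triangle.
- exact: torus_fun_cst.
move=> x; rewrite !big_ord_recl big_ord0 /= addr0 /in_triangle /sin_diff !phase_diff_shift.
have E (w : R * R) p q : pairing (a q) w - pairing (a p) w =
    (pairing (a q) w - pairing (a i) w) - (pairing (a p) w - pairing (a i) w) by ring.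
rewrite !(E _ j k) !(E _ k i) j1 k1 j2 k2 j3 k3 !subrr !(subr0, sub0r, addr0).
rewrite !(sinDpi, sinBpi) !(oppr_gt0, oppr_lt0).
by case: (ltgtP 0 (sin (phase_diff i j x))) => _;
  case: (ltgtP 0 (sin (phase_diff j k x))) => _;
  case: (ltgtP 0 (sin (phase_diff k i x))) => _.
Qed.

(** No two of the four phases are equal or opposite. *)
Definition generic (x : R * R) : bool :=
  [&& sin_diff 0 1 x != 0, sin_diff 0 2 x != 0, sin_diff 0 3 x != 0, sin_diff 1 2 x != 0,
    sin_diff 1 3 x != 0 & sin_diff 2 3 x != 0].

Lemma torus_fun_sin_diff_neq0 i j : torus_fun (fun x => sin_diff i j x != 0).
Proof. by apply: torus_fun_neg; apply: torus_fun_eq0; exact: torus_fun_sin_diff. Qed.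

Lemma torus_fun_generic : torus_fun generic.
Proof. by do ![apply: torus_fun_and; first exact: torus_fun_sin_diff_neq0];
  exact: torus_fun_sin_diff_neq0. Qed.

Hypothesis inj_a : forall i j, (i < j < 4)%N -> a i != a j.

Lemma torus_area_nongeneric : torus_area (fun x => ~~ generic x) = 0.
Proof.
apply: le_anti; rewrite torus_area_ge0 andbT.
pose z i j x := sin_diff i j x == 0.
have := @torus_area_count R [:: fun x => ~~ generic x] [:: z 0 1; z 0 2; z 0 3; z 1 2;
  z 1 3; z 2 3]%N.
rewrite !big_cons !big_nil !sin_diff_null ?inj_a// !addr0; apply.
- by move=> b /= [<-|//]; apply: torus_fun_neg; exact: torus_fun_generic.
- by move=> b /=; do 6![case=> [<-|]; first by apply: torus_fun_eq0;
  exact: torus_fun_sin_diff].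
- move=> x; rewrite !big_cons !big_nil /generic /z.
  by do 6![case: eqP => _].
Qed.

End Phases.

(** * Phases of a coamoeba point *)

Section CoamoebaPhases.
Context {R : realType}.
Notation lam := (@lebesgue_measure R).

Definition polar (r t : R) : R[i] := Complex (r * cos t) (r * sin t).

Lemma polarM r t r' t' : polar r t * polar r' t' = polar (r * r') (t + t').
Proof.
apply/eqP; rewrite eq_complex /=; apply/andP; split; apply/eqP.
  by rewrite cosD; ring.
by rewrite sinD; ring.
Qed.

Lemma polar10 : polar 1 0 = 1.
Proof. by rewrite /polar cos0 sin0 mulr0 mulr1. Qed.

Lemma polarV r t : r != 0 -> (polar r t)^-1 = polar r^-1 (- t).
Proof.
move=> r0; have H : polar r t * polar r^-1 (- t) = 1.
  by rewrite polarM mulfV// subrr polar10.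
have p0 : polar r t != 0.
  by apply/eqP => E; move: H; rewrite E mul0r => /eqP; rewrite eq_sym oner_eq0.
by apply: (mulfI p0); rewrite H mulfV.
Qed.

Lemma polarXz r t (n : int) : r != 0 -> polar r t ^ n = polar (r ^ n) (n%:~R * t).
Proof.
move=> r0.
have H (k : nat) : polar r t ^+ k = polar (r ^+ k) (k%:R * t).
  elim: k => [|k IH]; first by rewrite !expr0 mul0r polar10.
  by rewrite !exprS IH polarM -natr1; congr polar; ring.
case: n => n; first exact: H.
rewrite NegzE -!exprnN H polarV ?expf_neq0//; congr polar.
by rewrite mulrNz mulNr.
Qed.

Lemma normc_gt0 (z : R[i]) : z != 0 -> 0 < Normc.normc z.
Proof.
move=> z0; rewrite lt_neqAle eq_sym; apply/andP; split.
  by apply: contra z0 => /eqP/Normc.eq0_normc ->.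
by case: z {z0} => x y; exact: sqrtr_ge0.
Qed.

Lemma monomial_polar (c z1 z2 : R[i]) (m : int * int) : c != 0 -> z1 != 0 -> z2 != 0 ->
  c * (z1 ^ m.1 * z2 ^ m.2) =
  polar (Normc.normc c * (Normc.normc z1 ^ m.1 * Normc.normc z2 ^ m.2))
        (phase (arg c) m (Arg (z1, z2))).
Proof.
move=> c0 z10 z20.
have pE (z : R[i]) : z != 0 -> z = polar (Normc.normc z) (arg z).
  by move=> /argP[].
rewrite {1}(pE c c0) {1}(pE z1 z10) {1}(pE z2 z20) !polarXz ?gt_eqF ?normc_gt0//.
by rewrite !polarM.
Qed.

(** [X] and [Y] are the moduli of the two coordinates. Writing every [r i] through them retains the
    relation between the moduli of collinear monomials. *)
Lemma coamoeba_phases (f : laurent2 R) (a : nat -> int * int) (x : R * R) :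
  perm_eq (finsupp f) [:: a 0; a 1; a 2; a 3]%N -> coamoeba f x ->
  square x /\ exists X Y : R, 0 < X /\ 0 < Y /\
    let r i := Normc.normc (f (a i)) * (X ^ (a i).1 * Y ^ (a i).2) in
    let phi i := phase (arg (f (a i))) (a i) x in
   \sum_(i < 4) r i * cos (phi i) = 0 /\ \sum_(i < 4) r i * sin (phi i) = 0.
Proof.
move=> pe [[z1 z2] /= [z10 z20 fz]] <-{x}.
have [/andP[t1 t1'] _] := argP z10; have [/andP[t2 t2'] _] := argP z20.
split; first by split; rewrite /= in_itv /= ?t1 ?t2.
exists (Normc.normc z1), (Normc.normc z2); split; first exact: normc_gt0.
split; first exact: normc_gt0.
have fa0 i : (i < 4)%N -> f (a i) != 0.
  move=> i4; rewrite -mem_finsupp (perm_mem pe) !inE.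
  by case: i i4 => [|[|[|[|]]]]; rewrite ?eqxx ?orbT.
move: fz; rewrite /laurent_eval (perm_big _ pe) !(big_cons, big_nil) /=.
rewrite !monomial_polar ?fa0// => /eqP; rewrite eq_complex => /andP[/eqP re /eqP im].
by split; rewrite !(big_ord_recl, big_ord0).
Qed.

(** The coamoeba enters as a bare set, so monotonicity comes from the integral as a supremum over
    simple functions and from the outer measure of the sections. *)
Lemma lam2_mono (A B : set (R * R)) : A `<=` B ->
  ((lam \x lam) A <= (lam \x lam) B)%E.
Proof.
move=> AB; rewrite /product_measure1 !ge0_integralTE; [|by move=> x; exact: measure_ge0..].
apply: ereal_sup_le => y [h hA <-]; exists h => //= x; apply: le_trans (hA x) _.
by apply: le_mu_ext; exact: le_xsection.
Qed.

(** The union of [c] and the null region [b0] is measurable, contains the coamoeba and has no more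
    area than [c]. *)
Lemma area_le_torus_area (f : laurent2 R) (c b0 : R * R -> bool) : torus_fun c ->
  torus_fun b0 -> torus_area b0 = 0 ->
  coamoeba f `<=` square ->
  (forall x, coamoeba f x -> ~~ b0 x -> c x) -> (area (coamoeba f) <= (torus_area c)%:E)%E.
Proof.
move=> tc t0 mu0 fs H.
have : torus_area (fun x => b0 x || c x) <= torus_area c.
  have := @torus_area_count_ae R b0 [:: fun x => b0 x || c x] [:: c] t0 mu0.
  rewrite !big_cons !big_nil !addr0; apply.
  - by move=> b [<-|//]; exact: torus_fun_or.
  - by move=> b [<-|//].
  - by move=> x /negPf xb; rewrite !big_cons !big_nil xb.
rewrite -lee_fin; apply: le_trans; rewrite -torus_areaE; last exact: torus_fun_or.
apply: lam2_mono => x fx; split; first exact: fs.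
by rewrite /=; have [//|xb] := boolP (b0 x); exact: H.
Qed.

End CoamoebaPhases.

(** * Cyclic triangles among four positively dependent phases *)

Section Tournament.
Context {R : realType}.
Variables (al : nat -> R) (a : nat -> int * int).
Notation s := (sin_diff al a).
Notation tri := (in_triangle al a).
Notation generic := (generic al a).

Variables (r : nat -> R) (x : R * R).
Hypothesis r0 : forall i, (i < 4)%N -> 0 < r i.
Let phi i := phase (al i) (a i) x.
Hypothesis sum_cos : \sum_(i < 4) r i * cos (phi i) = 0.
Hypothesis sum_sin : \sum_(i < 4) r i * sin (phi i) = 0.

(** The imaginary part of the vanishing sum after rotating phase [j] to the positive real axis. *)
Lemma cross_sum j : r 0 * s j 0 x + r 1 * s j 1 x + r 2 * s j 2 x + r 3 * s j 3 x = 0.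
Proof.
move: sum_cos sum_sin; rewrite !big_ord_recl !big_ord0 /= !addr0.
rewrite /bump /= /sin_diff /phase_diff -!/(phi _) !sinB => c0 s0.
by transitivity ((r 0 * sin (phi 0) + (r 1 * sin (phi 1) + (r 2 * sin (phi 2) + r 3 * sin
  (phi 3)))) * cos (phi j)
  - (r 0 * cos (phi 0) + (r 1 * cos (phi 1) + (r 2 * cos (phi 2) + r 3 * cos (phi 3)))) *
    sin (phi j));
 [ring|rewrite c0 s0; ring].
Qed.

(* The signs of the sines orient the complete graph on the four phases; since
   0 is a positive combination, no vertex is a source or a sink, and such a
   tournament has exactly two cyclic triangles. *)
Lemma two_cyclic_triangles : generic x ->
  (2 <= tri 0 1 2 x + tri 0 1 3 x + tri 0 2 3 x + tri 1 2 3 x)%N.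
Proof.
have pos (u v w p q t : R) : 0 < u -> 0 < v -> 0 < w -> u * p + v * q + w * t = 0 ->
    ~~ [&& 0 < p, 0 < q & 0 < t] && ~~ [&& p < 0, q < 0 & t < 0].
  move=> u0 v0 w0 e; apply/andP; split; apply/and3P => -[h1 h2 h3].
    by move: e; apply/eqP; rewrite gt_eqF// !addr_gt0// mulr_gt0.
  by move: e; apply/eqP;
    rewrite lt_eqF// -oppr_gt0 !opprD -!mulrN !addr_gt0// mulr_gt0// oppr_gt0.
have ss i : s i i x = 0 by rewrite /sin_diff /phase_diff subrr sin0.
have c0 := cross_sum 0; have c1 := cross_sum 1; have c2 := cross_sum 2;
  have c3 := cross_sum 3.
rewrite ?ss ?mulr0 ?addr0 ?add0r in c0 c1 c2 c3.
have := pos _ _ _ _ _ _ (r0 (isT : (1 < 4)%N)) (r0 (isT : (2 < 4)%N)) (r0 (isT : (3 <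
  4)%N)) c0.
have := pos _ _ _ _ _ _ (r0 (isT : (0 < 4)%N)) (r0 (isT : (2 < 4)%N)) (r0 (isT : (3 <
  4)%N)) c1.
have := pos _ _ _ _ _ _ (r0 (isT : (0 < 4)%N)) (r0 (isT : (1 < 4)%N)) (r0 (isT : (3 <
  4)%N)) c2.
have := pos _ _ _ _ _ _ (r0 (isT : (0 < 4)%N)) (r0 (isT : (1 < 4)%N)) (r0 (isT : (2 <
  4)%N)) c3.
rewrite /in_triangle /generic (sin_diffC al a 0 1) (sin_diffC al a 0 2) (sin_diffC al a 0
  3) (sin_diffC al a 1 2) (sin_diffC al a 1 3) (sin_diffC al a 2 3).
rewrite !(oppr_gt0, oppr_lt0).
by case: (ltgtP 0 (s 0 1 x)) => //= _; case: (ltgtP 0 (s 0 2 x)) => //= _;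
  case: (ltgtP 0 (s 0 3 x)) => //= _; case: (ltgtP 0 (s 1 2 x)) => //= _;
  case: (ltgtP 0 (s 1 3 x)) => //= _; case: (ltgtP 0 (s 2 3 x)) => //= _.
Qed.

End Tournament.

(** * Rotations of one vertex of a triangle *)

Section CyclicCount.
Variables (N : nat) (b : nat -> bool).
Let n := N.*2.+1.
Hypothesis bn : forall j, b (j + n) = b j.

Lemma periodic_sum k : (\sum_(j < n) b (j + k) = \sum_(j < n) b j)%N.
Proof.
elim: k => [|k IH]; first by apply: eq_bigr => j _; rewrite addn0.
rewrite -IH big_ord_recr [in RHS]big_ord_recl [LHS]addnC /=.
congr (_ + _)%N; last by apply: eq_bigr => j _; rewrite /bump /= add1n addSnnS.
by rewrite add0n -(bn k) /n; congr (nat_of_bool (b _)); lia.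
Qed.

(** Summing [b j + b (j + N)], which is at most 1, over a period counts everything twice; twice the
    count is at most [2N + 1], and parity gives [N]. *)
Lemma count_no_pair : (forall j, ~~ (b j && b (j + N)%N)) -> (\sum_(j < n) b j <= N)%N.
Proof.
move=> H; have : (\sum_(j < n) (b j + b (j + N)) <= n)%N.
  rewrite -[leqRHS]card_ord -sum1_card leq_sum// => j _.
  by move: (H j); case: (b j); case: (b (j + N)).
rewrite big_split /= periodic_sum; move: (\sum_(j < n) b j)%N => S; rewrite /n; lia.
Qed.

(** A period starting at [k] ends with [N] consecutive misses, leaving [N + 1] places. *)
Lemma count_gap k : (forall i, (0 < i <= N)%N -> ~~ b (k + N + i)%N) ->
  (\sum_(j < n) b j <= N.+1)%N.
Proof.
move=> H; rewrite -(periodic_sum k) (_ : n = N.+1 + N)%N; last by rewrite /n; lia.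
rewrite big_split_ord /= [X in (_ + X)%N]big1 ?addn0; last first.
  move=> i _; apply/eqP; rewrite eqb0.
  rewrite (_ : (N.+1 + i + k)%N = (k + N + i.+1)%N); last by lia.
  by apply: H; rewrite ltn_ord.
rewrite -[leqRHS]card_ord -sum1_card leq_sum// => j _; exact: leq_b1.
Qed.
End CyclicCount.

(** * Trigonometry of a triangle with one vertex at angle zero *)

Section ThreePhases.
Context {R : realType}.
Implicit Types g h : R.

(* The origin is interior to the triangle with vertices at angles 0, g, h. *)
Definition surround g h : bool :=
  [&& 0 < sin g, 0 < sin (h - g) & sin h < 0] ||
  [&& sin g < 0, sin (h - g) < 0 & 0 < sin h].

Lemma surround_pi g h : surround g h -> ~~ surround (g + pi) h.
Proof.
rewrite /surround sinDpi oppr_gt0 oppr_lt0.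
by case/orP=> /and3P[h1 h2 h3]; rewrite !(lt_gtF h1) !(lt_gtF h3) !(andbF, andFb).
Qed.

Lemma surround_sign g h : surround g h -> sin g * sin h < 0.
Proof. by case/orP=> /and3P[h1 h2 h3]; nra. Qed.

(** Both [g] and [g'] point into the sector opposite to that of the angles 0 and [h], which is at
    most a right angle. The identity [E] is the inner product of the two directions, each scaled by
    [sin h] and expanded along the angles 0 and [h]. *)
Lemma surround_same_sector g g' h : surround g h -> surround g' h -> 0 <= cos h ->
  0 < cos (g' - g).
Proof.
move=> /orP S1 /orP S2 ch.
have E : sin h ^+ 2 * cos (g' - g) = sin (h - g) * sin (h - g') + sin g * sin g' +
    (sin (h - g) * sin g' + sin g * sin (h - g')) * cos h.
  by rewrite sin2cos2 cosB !sinB; have := sin2cos2 h; move: (sin h) => sh E; ring: E.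
suff : 0 < sin h ^+ 2 * cos (g' - g).
  rewrite pmulr_rgt0// exprn_even_gt0//=.
  by case: S1 => /and3P[_ _]; [move/lt_eqF->|move/gt_eqF->].
rewrite {}E; apply: ltr_wpDr; first apply: mulr_ge0 => //.
  by case: S1 => /and3P[h1 h2 h3]; case: S2 => /and3P[h4 h5 h6]; nra.
by case: S1 => /and3P[h1 h2 h3]; case: S2 => /and3P[h4 h5 h6]; nra.
Qed.

(** An angle between [g] and [g + de] lies on the same side as they do of the line through angle 0,
    so its antipode lies on the side of [h]. *)
Lemma surround_antipode g h de ga : surround g h -> surround (g + de) h ->
  0 < ga < de -> de < pi -> ~~ surround (g + ga + pi) h.
Proof.
move=> /surround_sign s1 /surround_sign s2 /andP[g0 gd] dp.
apply/negP => /surround_sign; rewrite sinDpi.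
have E : sin de * sin (g + ga) = sin (de - ga) * sin g + sin ga * sin (g + de).
  by rewrite sinB !sinD; ring.
have p1 : 0 < sin de by rewrite sin_gt0_pi// (lt_trans g0 gd).
have p2 : 0 < sin (de - ga) by rewrite sin_gt0_pi//; apply/andP; split; lra.
have p3 : 0 < sin ga by rewrite sin_gt0_pi// g0 (lt_trans gd dp).
have : sin de * (sin (g + ga) * sin h) < 0.
  by rewrite mulrA E mulrDl -!mulrA; nra.
by rewrite pmulr_rlt0//; lra.
Qed.

(** For [cos h >= 0] no two positions [N] steps apart both surround the origin. Otherwise such a
    pair may exist, but then the antipodes of the positions between them form a gap of length
    [N]. *)
Lemma surround_count (N : nat) g h : (0 < N)%N ->
  (\sum_(j < N.*2.+1) surround (g + (pi *+ 2) * j%:R / (N.*2.+1)%:R) h <=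
   N + (cos h < 0)%R)%N.
Proof.
move=> N0; set n := N.*2.+1; pose x j := g + pi *+ 2 * j%:R / n%:R.
have n0 : n%:R != 0 :> R by rewrite pnatr_eq0.
have n0' : 0 < n%:R :> R by rewrite ltr0n.
have nE : n%:R = 2 * N%:R + 1 :> R by rewrite /n -natr1 -mul2n natrM.
have xD j k : x (j + k)%N = x j + pi *+ 2 * k%:R / n%:R.
  by rewrite /x natrD; ring.
have xn j : surround (x (j + n)%N) h = surround (x j) h.
  rewrite xD mulfK//.
  by rewrite /surround sinD2pi opprD addrA -(sinD2pi (h - x j - _)) subrK.
have pN : 0 < N%:R :> R by rewrite ltr0n.
have p0 : 0 < pi :> R by exact: pi_gt0.
pose de : R := pi *+ 2 * N%:R / n%:R.
(* [N] steps fall short of a half-turn by [pi / n], which is acute as [n] is at least 3, so [cos de]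
   is negative. *)
have deE : de = pi - pi / n%:R by rewrite /de nE; field; rewrite -nE.
have [ch|ch] := ltP (cos h) 0; last first.
  rewrite addn0; apply: (@count_no_pair N (fun j => surround (x j) h)) => // j.
  apply/negP => /andP[/surround_same_sector H /H /(_ ch)].
  rewrite xD addrAC subrr add0r -/de deE [pi - _]addrC cosDpi cosN.
  rewrite oppr_gt0; apply/negP; rewrite -leNgt ltW// cos_gt0_pihalf//.
  apply/andP; split; first by rewrite (lt_trans _ (divr_gt0 p0 n0'))// oppr_lt0 divr_gt0.
  by rewrite ltr_pM2l// ltf_pV2 ?posrE// ltr_nat /n; lia.
rewrite addn1.
have [/existsP[k /andP[k1 k2]]|/existsPn H] := boolP [exists k : 'I_n, surround (x k) h &&
  surround (x (k + N)%N) h].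
  apply: (@count_gap N (fun j => surround (x j) h) _ k) => // i /andP[i0 iN].
  rewrite xD -/de in k2.
  (* Position [k + N + i] is the antipode of an angle strictly between positions [k] and [k + N],
     since [0 < 2i - 1 < 2N]. *)
  have -> : x (k + N + i)%N = x k + (pi * (2 * i%:R - 1) / n%:R) + pi.
    by rewrite -addnA xD natrD -[X in _ = _ + X](mulfK n0) nE; field; rewrite -nE.
  have i1 : 1 <= i%:R :> R by rewrite ler1n.
  have iN' : i%:R <= N%:R :> R by rewrite ler_nat.
  apply: surround_antipode k1 k2 _ _.
    by rewrite /de divr_gt0 ?mulr_gt0//=; [rewrite ltr_pM2r ?invr_gt0//; nra|lra].
  by rewrite deE ltrBlDr ltrDl divr_gt0.
apply: leq_trans (leqnSn N); apply: (@count_no_pair N (fun j => surround (x j) h)) => // j.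
(* [H] speaks only of indices below [n]; periodicity extends it to all [j]. *)
have Hm : forall j, surround (x (j %% n)%N) h = surround (x j) h.
  move=> i; rewrite [in RHS](divn_eq i n) addnC.
  by elim: (i %/ n)%N => [|q IH]; rewrite ?addn0// mulSn addnCA addnC xn.
have := H (Ordinal (ltn_pmod j (isT : (0 < n)%N))); rewrite /= Hm -(Hm (j %% n + N)%N).
by rewrite modnDml Hm.
Qed.
End ThreePhases.

(** * Area bounds *)

Definition two_of4 (b1 b2 b3 b4 : bool) : bool :=
  [|| b1 && b2, b1 && b3, b1 && b4, b2 && b3, b2 && b4 | b3 && b4].

Lemma two_of4E b1 b2 b3 b4 : two_of4 b1 b2 b3 b4 = (2 <= b1 + b2 + b3 + b4)%N.
Proof. by case: b1 b2 b3 b4 => [] [] [] []. Qed.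

Section TwoTriangles.
Context {R : realType}.
Variables (al : nat -> R) (a : nat -> int * int).
Notation tri := (in_triangle al a).

Definition two_triangles x :=
  two_of4 (tri 0 1 2 x) (tri 0 1 3 x) (tri 0 2 3 x) (tri 1 2 3 x).

Lemma torus_fun_two_triangles : torus_fun two_triangles.
Proof. by repeat first [exact: torus_fun_in_triangle|apply: torus_fun_and|apply:
  torus_fun_or]. Qed.

End TwoTriangles.

(** * Circuits without three collinear exponents *)

Section NonCollinear.
Context {R : realType}.
Variables (f : laurent2 R) (a : nat -> int * int).
Hypothesis supp_f : perm_eq (finsupp f) [:: a 0; a 1; a 2; a 3]%N.
Hypothesis inj_a : forall i j, (i < j < 4)%N -> a i != a j.
Let al i := arg (f (a i)).

Lemma coeff_neq0 i : (i < 4)%N -> f (a i) != 0.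
Proof.
move=> i4; rewrite -mem_finsupp (perm_mem supp_f) !inE.
by case: i i4 => [|[|[|[|]]]]; rewrite ?eqxx ?orbT.
Qed.

Lemma coamoeba_square : coamoeba f `<=` square.
Proof. by move=> x /(coamoeba_phases supp_f)[]. Qed.

Lemma coamoeba_two_triangles x : coamoeba f x -> generic al a x -> two_triangles al a x.
Proof.
move=> /(coamoeba_phases supp_f)[_ [u [v [pu [pv [c0 s0]]]]]] gx.
pose r i := Normc.normc (f (a i)) * (u ^ (a i).1 * v ^ (a i).2).
have r0 i : (i < 4)%N -> 0 < r i.
  by move=> i4; rewrite /r !mulr_gt0 ?exprz_gt0// normc_gt0// coeff_neq0.
by rewrite /two_triangles two_of4E; exact: (two_cyclic_triangles (r := r) r0 c0 s0 gx).
Qed.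

Lemma area_noncollinear :
  cross (a 0) (a 1) (a 2) != 0 -> cross (a 0) (a 1) (a 3) != 0 -> cross (a 0) (a 2) (a 3)
    != 0 -> cross (a 1) (a 2) (a 3) != 0 ->
  (area (coamoeba f) <= (2 * pi ^+ 2)%:E)%E.
Proof.
move=> d1 d2 d3 d4.
have mu0 := torus_area_nongeneric al inj_a.
have tg : torus_fun (fun x => ~~ generic al a x) by apply: torus_fun_neg;
  exact: torus_fun_generic.
apply: le_trans (area_le_torus_area (torus_fun_two_triangles al a) tg mu0 coamoeba_square
  _) _.
  by move=> x fx; rewrite negbK; exact: coamoeba_two_triangles.
have : torus_area (two_triangles al a) + (torus_area (two_triangles al a) + 0) <=
  torus_area (in_triangle al a 0 1 2) +
    (torus_area (in_triangle al a 0 1 3) + (torus_area (in_triangle al a 0 2 3) +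
      (torus_area (in_triangle al a 1 2 3) + 0))).
  have := @torus_area_count R [:: two_triangles al a; two_triangles al a]
    [:: in_triangle al a 0 1 2; in_triangle al a 0 1 3; in_triangle al a 0 2 3;
      in_triangle al a 1 2 3].
  rewrite !big_cons !big_nil; apply.
  - by move=> b /=; do 2![case=> [<-|]; first exact: torus_fun_two_triangles].
  - by move=> b /=; do 4![case=> [<-|]; first exact: torus_fun_in_triangle].
  - move=> x; rewrite !big_cons !big_nil /two_triangles.
    by case: (in_triangle al a 0 1 2 x); case: (in_triangle al a 0 1 3 x);
      case: (in_triangle al a 0 2 3 x);
      case: (in_triangle al a 1 2 3 x).
move: (torus_area_in_triangle al d1) (torus_area_in_triangle al d2) (torus_area_in_triangle
  al d3) (torus_area_in_triangle al d4); rewrite lee_fin.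
move: (torus_area (two_triangles al a)) (torus_area (in_triangle al a 0 1 2)) (torus_area
  (in_triangle al a 0 1 3)).
move: (torus_area (in_triangle al a 0 2 3)) (torus_area (in_triangle al a 1 2 3)) => m4 m3
  m m1 m2.
clear; lra.
Qed.

End NonCollinear.

(** * Torus regions for three collinear exponents *)

Section Collinear.
Context {R : realType}.
Variables (al : nat -> R) (a : nat -> int * int) (p n : nat).
Hypothesis p0 : (0 < p)%N.
Hypothesis pn : (p < n)%N.
Hypothesis cop : coprime p n.
(* [a 1] lies on the segment from [a 0] to [a 2], at the ratio p / n. *)
Hypothesis col1 : ((a 1).1 - (a 0).1) * n%:Z = ((a 2).1 - (a 0).1) * p%:Z.
Hypothesis col2 : ((a 1).2 - (a 0).2) * n%:Z = ((a 2).2 - (a 0).2) * p%:Z.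
Hypothesis d023 : cross (a 0) (a 2) (a 3) != 0.
Notation s := (sin_diff al a).
Notation tri := (in_triangle al a).
Notation W := (tri 0 1 2).

Lemma denominator_neq0 : n%:R != 0 :> R.
Proof. by rewrite pnatr_eq0 -lt0n (ltn_trans p0). Qed.

(** A translation moves phase 1 relative to phase 0 in a fixed proportion to phase 2, so these
    phases cannot be moved independently. *)
Lemma pairing_collinear v :
  pairing (a 1) v - pairing (a 0) v =
  p%:R / n%:R * (pairing (a 2) v - pairing (a 0) v) :> R.
Proof.
have n0 := denominator_neq0.
have /(congr1 (fun z : int => z%:~R : R)) := col1.
have /(congr1 (fun z : int => z%:~R : R)) := col2.
rewrite !rmorphM !rmorphB /= -!pmulrn /pairing => e2 e1.
apply: (mulIf n0).
rewrite [RHS](_ : _ = p%:R * ((a 2).1%:~R * v.1 + (a 2).2%:~R * v.2 - ((a 0).1%:~R * v.1 +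
  (a 0).2%:~R * v.2))); last by field.
transitivity (((a 1).1%:~R - (a 0).1%:~R) * n%:R * v.1 + ((a 1).2%:~R - (a 0).2%:~R) * n%:R
  * v.2); first by ring.
by rewrite e1 e2; ring.
Qed.

Lemma phase_diff_shift0 i j x (v : R * R) :
  phase_diff al a i j (x + v) = phase_diff al a i j x +
  ((pairing (a j) v - pairing (a 0) v) - (pairing (a i) v - pairing (a 0) v)).
Proof. by rewrite phase_diff_shift; congr (_ + _); ring. Qed.

(* The line through phase 3 misses the sector spanned by phases 0 and 2. *)
Definition line_outside x := 0 < s 0 3 x * s 2 3 x.
(** The set X of the overview: the generic part of [W] that meets neither triangle 023 nor its image
    under the flip of phase 3. *)
Definition triangle_outside x := W x && line_outside x.
(** Accounts for the extra unit that [surround_count] allows when the cosine is negative. *)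
Definition obtuse_outside x := (cos (phase_diff al a 0 2 x) < 0) && line_outside x.

Lemma torus_fun_outside : torus_fun line_outside.
Proof.
by apply: torus_fun_lt; [exact: torus_fun_cst|apply: torus_fun_mul;
  exact: torus_fun_sin_diff].
Qed.

Lemma torus_fun_triangle_outside : torus_fun triangle_outside.
Proof. by apply: torus_fun_and;
  [exact: torus_fun_in_triangle|exact: torus_fun_outside]. Qed.

Lemma torus_fun_obtuse_outside : torus_fun obtuse_outside.
Proof.
apply: torus_fun_and; last exact: torus_fun_outside.
by apply: torus_fun_lt; [exact: torus_fun_cos|exact: torus_fun_cst].
Qed.

(** Flipping phase 2 alone reverses the sign of the product, so two translates are disjoint. *)
Lemma torus_area_outside : torus_area line_outside <= 2 * pi ^+ 2.
Proof.
have [v [v2 v3]] := exists_shift (pi : R) 0 d023.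
suff : 2%:R * torus_area line_outside <= torus_area (fun=> true : bool) by rewrite
  torus_area_true; lra.
apply: (@torus_area_translates_le _ _ _ _ (nth 0 [:: 0; v])).
- exact: torus_fun_outside.
- exact: torus_fun_cst.
move=> x; rewrite !big_ord_recl big_ord0 /= addr0 /line_outside /sin_diff
  !phase_diff_shift0.
rewrite v2 v3 !subrr sub0r ?subr0 addr0 sinBpi mulrN oppr_gt0.
by case: ltgtP.
Qed.

(* Flipping phase 2 and turning phase 3 by a right angle give four disjoint
   translates. *)
Lemma torus_area_obtuse_outside : torus_area obtuse_outside <= pi ^+ 2.
Proof.
have [v1 [a1 b1]] := exists_shift (pi : R) 0 d023.
have [v2 [a2 b2]] := exists_shift (0 : R) (pi / 2) d023.
have [v3 [a3 b3]] := exists_shift (pi : R) (pi / 2) d023.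
suff : 4%:R * torus_area obtuse_outside <= torus_area (fun=> true : bool) by rewrite
  torus_area_true; lra.
apply: (@torus_area_translates_le _ _ _ _ (nth 0 [:: 0; v1; v2; v3])).
- exact: torus_fun_obtuse_outside.
- exact: torus_fun_cst.
move=> x; rewrite !big_ord_recl big_ord0 /= addr0 /obtuse_outside /line_outside /sin_diff
  !phase_diff_shift0.
rewrite a1 b1 a2 b2 a3 b3 !subrr !subr0 !addr0 !sub0r sinBpi !cosDpi !sinDpihalf.
rewrite addrA sinBpi sinDpihalf !mulrN !(oppr_gt0, oppr_lt0).
(* The quarter-turn of phase 3 replaces the product of sines by the product of cosines; the two
   products cannot both have the sign opposite to their sum. *)
have : cos (phase_diff al a 0 2 x) =
    cos (phase_diff al a 0 3 x) * cos (phase_diff al a 2 3 x) +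
    sin (phase_diff al a 0 3 x) * sin (phase_diff al a 2 3 x).
  by rewrite -cosB; congr cos; rewrite /phase_diff; ring.
move: (cos (phase_diff al a 0 2 x)) => c.
move: (_ * _) (_ * _) => c' s' E.
case: (ltgtP 0 c) => c0; case: (ltgtP 0 s') => s0; case: (ltgtP 0 c') => c0' //; lra.
Qed.

(* A translation fixing the phases 0, 2, 3 turns phase 1 by any multiple of
   2 pi / n, as p is invertible modulo n. *)
Lemma rotate_middle (k : nat) : exists v : R * R, forall x,
  [/\ s 0 1 (x + v) = sin (phase_diff al a 0 1 x + pi *+ 2 * k%:R / n%:R),
      s 1 2 (x + v) = sin (phase_diff al a 0 2 x - (phase_diff al a 0 1 x + pi *+ 2 * k%:R
        / n%:R)),
      s 2 0 (x + v) = - s 0 2 x & s 0 3 (x + v) = s 0 3 x /\ s 2 3 (x + v) = s 2 3 x].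
Proof.
have n0 := denominator_neq0.
(* Bezout: [km * p = kn * n + 1]. Moving phase 2 by [k * km] full turns moves phase 1 by [k / n] of
   a turn plus [k * kn] full turns. *)
case: (egcdnP n p0) => km kn e _; rewrite (eqP cop) in e.
have [v [v2 v3]] := exists_shift (pi *+ 2 * (k * km)%:R : R) 0 d023.
exists v => x.
have v1 : pairing (a 1) v - pairing (a 0) v = pi *+ 2 * k%:R / n%:R + pi *+ 2 * (k * kn)%:R.
  rewrite pairing_collinear v2.
  transitivity (pi *+ 2 * k%:R * (km * p)%:R / n%:R : R); first by rewrite !natrM; ring.
  by rewrite e natrD !natrM; field.
have sP u m : sin (u + pi *+ 2 * m%:R) = sin u :> R.
  by rewrite -[RHS](sin_period m) -pmulrn; congr sin; ring.
have sM u m : sin (u - pi *+ 2 * m%:R) = sin u :> R.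
  by rewrite -[LHS](sP _ m) subrK.
rewrite /sin_diff !phase_diff_shift0 v1 v2 v3 !subrr !sub0r !subr0 !addr0; split.
- by rewrite addrA sP.
- rewrite -[RHS](sP _ (k * km)%N) -[RHS](sM _ (k * kn)%N); congr sin.
  by rewrite (phase_diffD al a 0 1 2); ring.
- by rewrite sM; exact: sin_diffC.
- by rewrite sM.
Qed.

Lemma triangle_outside_surround x v g :
  s 0 1 (x + v) = sin g -> s 1 2 (x + v) = sin (phase_diff al a 0 2 x - g) ->
  s 2 0 (x + v) = - s 0 2 x -> s 0 3 (x + v) = s 0 3 x /\ s 2 3 (x + v) = s 2 3 x ->
  triangle_outside (x + v) = surround g (phase_diff al a 0 2 x) && line_outside x.
Proof.
by move=> e1 e2 e3 [e4 e5];
  rewrite /triangle_outside /line_outside /in_triangle e1 e2 e3 e4 e5 oppr_gt0 oppr_lt0.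
Qed.

(** For [n = 2N + 1], the [n] rotations of phase 1 cover [line_outside] at most [N] times, plus once
    on [obtuse_outside], for a total of at most [(2N + 1) * pi ^+ 2]. For even [n] a half-turn of
    phase 1 is available and gives two disjoint translates inside [line_outside]. *)
Lemma torus_area_triangle_outside : torus_area triangle_outside <= pi ^+ 2.
Proof.
have n0 := denominator_neq0.
have n0' : 0 < n%:R :> R by rewrite ltr0n; lia.
have [on|en] := boolP (odd n).
  pose N := n./2; have nE : n = N.*2.+1 by rewrite -[LHS]odd_double_half on.
  have N0 : (0 < N)%N by lia.
  have /choice[v Hv] := rotate_middle.
  have : n%:R * torus_area triangle_outside <= \sum_(c <- obtuse_outside :: nseq N
    line_outside) torus_area c.
    apply: (@torus_area_translates _ _ _ v); first exact: torus_fun_triangle_outside.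
      move=> c /= [<-|]; first exact: torus_fun_obtuse_outside.
      by elim: (N) => //= m IH [<-|//]; exact: torus_fun_outside.
    move=> x; rewrite big_cons big_nseq iter_addn_0.
    rewrite (eq_bigr (fun j : 'I_n => (surround (phase_diff al a 0 1 x + pi *+ 2 * j%:R /
      n%:R) (phase_diff al a 0 2 x) && line_outside x : nat))); last first.
      by move=> j _; case: (Hv j x) => e1 e2 e3 e4;
        rewrite (triangle_outside_surround e1 e2 e3 e4).
    rewrite /obtuse_outside; case: (line_outside x); last by rewrite big1 // => j _;
      rewrite andbF.
    rewrite andbT mul1n addnC;
      apply: leq_trans (surround_count (phase_diff al a 0 1 x) (phase_diff al a 0 2 x) N0).
    by rewrite -nE; apply: leq_sum => j _; rewrite andbT.
  rewrite big_cons big_nseq iter_addr addr0 -[_ *+ N]mulr_natl => le.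
  have mY := torus_area_obtuse_outside; have mU := torus_area_outside.
  have nR : n%:R = 2 * N%:R + 1 :> R by rewrite nE -natr1 -mul2n natrM.
  have NU : N%:R * torus_area line_outside <= N%:R * (2 * pi ^+ 2) by rewrite ler_wpM2l.
  rewrite -(ler_pM2l n0') {2}nR; move: le mY NU.
  move: (N%:R * torus_area line_outside) (n%:R * torus_area triangle_outside) (torus_area
    obtuse_outside).
  by move=> m1 m2 m3; lra.
have nE : n = n./2.*2 by rewrite -[LHS]odd_double_half (negPf en).
have [v Hv] := rotate_middle n./2.
suff : 2%:R * torus_area triangle_outside <= torus_area line_outside.
  by move: torus_area_outside;
    move: (torus_area line_outside) (torus_area triangle_outside) => m1 m2; lra.
apply: (@torus_area_translates_le _ _ _ _ (nth 0 [:: 0; v])).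
- exact: torus_fun_triangle_outside.
- exact: torus_fun_outside.
move=> x; rewrite !big_ord_recl big_ord0 /= addr0.
case: (Hv x) => e1 e2 e3 e4; rewrite (triangle_outside_surround e1 e2 e3 e4).
have -> : pi *+ 2 * (n./2)%:R / n%:R = pi :> R.
  have -> : n%:R = 2 * (n./2)%:R :> R by rewrite {1}nE -mul2n natrM.
  by field; rewrite pnatr_eq0; lia.
rewrite (_ : triangle_outside x = surround (phase_diff al a 0 1 x) (phase_diff al a 0 2 x)
  && line_outside x); last first.
  rewrite -[in LHS](addr0 x); apply: triangle_outside_surround; rewrite ?addr0 //.
    by rewrite /sin_diff (phase_diffD al a 0 1 2) addrAC subrr add0r.
  exact: sin_diffC.
case: (line_outside x); last by rewrite !andbF.
rewrite !andbT; case: (boolP (surround _ (phase_diff al a 0 2 x))) =>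
  [/surround_pi/negPf->//|_].
by case: surround.
Qed.

End Collinear.

(** * The coamoeba for three collinear exponents *)

Section CollinearArea.
Context {R : realType}.
Variables (f : laurent2 R) (a : nat -> int * int) (p n : nat).
Hypothesis supp_f : perm_eq (finsupp f) [:: a 0; a 1; a 2; a 3]%N.
Hypothesis inj_a : forall i j, (i < j < 4)%N -> a i != a j.
Hypothesis p0 : (0 < p)%N.
Hypothesis pn : (p < n)%N.
Hypothesis cop : coprime p n.
Hypothesis col1 : ((a 1).1 - (a 0).1) * n%:Z = ((a 2).1 - (a 0).1) * p%:Z.
Hypothesis col2 : ((a 1).2 - (a 0).2) * n%:Z = ((a 2).2 - (a 0).2) * p%:Z.
Hypothesis d023 : cross (a 0) (a 2) (a 3) != 0.
Hypothesis d013 : cross (a 0) (a 1) (a 3) != 0.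
Hypothesis d123 : cross (a 1) (a 2) (a 3) != 0.
Let al i := arg (f (a i)).
Notation s := (sin_diff al a).
Notation tri := (in_triangle al a).
Notation generic := (generic al a).
Notation W := (tri 0 1 2).
Notation triangle_outside := (triangle_outside al a).

(* A coamoeba point in [overlap] satisfies [side_product < middle_power], one in
   [overlap_flip] the opposite inequality. Flipping phase 3 exchanges the two
   sets and preserves both functions. *)
Definition overlap x := W x && tri 0 2 3 x.
Definition overlap_flip x := W x &&
  ([&& 0 < s 0 2 x, s 2 3 x < 0 & s 3 0 x < 0] ||
   [&& s 0 2 x < 0, 0 < s 2 3 x & 0 < s 3 0 x]).

(** The constant kappa of the overview. *)
Definition coeff_ratio : R :=
  Normc.normc (f (a 0)) ^+ (n - p) * Normc.normc (f (a 2)) ^+ p /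
  Normc.normc (f (a 1)) ^+ n.
Definition side_product x : R := `|s 1 2 x| ^+ (n - p) * `|s 0 1 x| ^+ p.
Definition middle_power x : R := coeff_ratio * `|s 0 2 x| ^+ n.
(** The coamoeba avoids [overlap_missed] and [flip_missed]. The latter has the area of
    [overlap_rest], and [overlap_missed] and [overlap_rest] cover [overlap], so the two avoided
    areas add up to at least that of [overlap]. *)
Definition overlap_missed x := overlap x && ~~ (side_product x < middle_power x).
Definition overlap_rest x := overlap x && ~~ (middle_power x < side_product x).
Definition flip_missed x := overlap_flip x && ~~ (middle_power x < side_product x).

Lemma torus_fun_overlap : torus_fun overlap.
Proof. by apply: torus_fun_and; exact: torus_fun_in_triangle. Qed.

Lemma torus_fun_overlap_flip : torus_fun overlap_flip.
Proof.
apply: torus_fun_and; first exact: torus_fun_in_triangle.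
by apply: torus_fun_or; repeat first
  [exact: torus_fun_sin_diff_gt0|exact: torus_fun_sin_diff_lt0|apply: torus_fun_and].
Qed.

Lemma torus_fun_side_product : torus_fun side_product.
Proof.
by apply: torus_fun_mul; apply: torus_fun_exp; apply: torus_fun_norm;
  exact: torus_fun_sin_diff.
Qed.

Lemma torus_fun_middle_power : torus_fun middle_power.
Proof.
apply: torus_fun_mul; first exact: torus_fun_cst.
by apply: torus_fun_exp; apply: torus_fun_norm; exact: torus_fun_sin_diff.
Qed.

Lemma torus_fun_side_not_lt : torus_fun (fun x => ~~ (side_product x < middle_power x)).
Proof.
by apply: torus_fun_neg; apply: torus_fun_lt;
  [exact: torus_fun_side_product|exact: torus_fun_middle_power].
Qed.

Lemma torus_fun_middle_not_lt : torus_fun (fun x => ~~ (middle_power x < side_product x)).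
Proof.
by apply: torus_fun_neg; apply: torus_fun_lt;
  [exact: torus_fun_middle_power|exact: torus_fun_side_product].
Qed.

Lemma torus_fun_overlap_missed : torus_fun overlap_missed.
Proof. by apply: torus_fun_and;
  [exact: torus_fun_overlap|exact: torus_fun_side_not_lt]. Qed.

Lemma torus_fun_overlap_rest : torus_fun overlap_rest.
Proof. by apply: torus_fun_and;
  [exact: torus_fun_overlap|exact: torus_fun_middle_not_lt]. Qed.

Lemma torus_fun_flip_missed : torus_fun flip_missed.
Proof. by apply: torus_fun_and;
  [exact: torus_fun_overlap_flip|exact: torus_fun_middle_not_lt]. Qed.

(** Adding [pi] to phase 3 while fixing phase 2, both relative to phase 0, fixes phase 1 as well by
    collinearity. *)
Lemma flip_last : exists v : R * R, forall x,
  [/\ overlap_flip (x + v) = overlap x, side_product (x + v) = side_product x &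
    middle_power (x + v) = middle_power x].
Proof.
have [v [v2 v3]] := exists_shift (0 : R) pi d023.
exists v => x.
have v1 : pairing (a 1) v - pairing (a 0) v = 0.
  by rewrite (pairing_collinear p0 pn col1 col2) v2 mulr0.
have E i j : (i < 3)%N -> (j < 3)%N -> s i j (x + v) = s i j x.
  have H k : (k < 3)%N -> pairing (a k) v - pairing (a 0) v = 0.
    by case: k => [|[|[|//]]] _ //; rewrite subrr.
  by move=> i3 j3; rewrite /sin_diff phase_diff_shift0 !H// subrr addr0.
have e23 : s 2 3 (x + v) = - s 2 3 x.
  by rewrite /sin_diff phase_diff_shift0 v2 v3 subr0 sinDpi.
have e30 : s 3 0 (x + v) = - s 3 0 x.
  by rewrite /sin_diff phase_diff_shift0 v3 subrr sub0r sinBpi.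
split; last 2 first.
- by rewrite /side_product !E.
- by rewrite /middle_power !E.
by rewrite /overlap_flip /overlap /in_triangle e23 e30 !E// !(oppr_gt0, oppr_lt0).
Qed.

Lemma torus_area_overlap_flip : torus_area overlap_flip = torus_area overlap.
Proof.
have [v Hv] := flip_last; rewrite -(torus_area_shift v torus_fun_overlap_flip).
by congr torus_area; apply/funext => x; case: (Hv x).
Qed.

Lemma torus_area_flip_missed : torus_area flip_missed = torus_area overlap_rest.
Proof.
have [v Hv] := flip_last; rewrite -(torus_area_shift v torus_fun_flip_missed).
by congr torus_area; apply/funext => x; rewrite /flip_missed /overlap_rest;
  case: (Hv x) => -> -> ->.
Qed.

Section Point.
Variable x : R * R.
Hypothesis fx : coamoeba f x.

(** In the first relation the coordinate moduli cancel because [n a_1 = (n - p) a_0 + p a_2]; the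
    other two are [cross_sum] at phases 2 and 0. *)
Lemma coamoeba_moduli : exists r : nat -> R, [/\ forall i, (i < 4)%N -> 0 < r i,
  r 0%N ^+ (n - p) * r 2%N ^+ p = coeff_ratio * r 1%N ^+ n,
  r 1%N * s 1 2 x = - (r 0%N * s 0 2 x) + r 3%N * s 2 3 x &
  r 1%N * s 0 1 x = - (r 2%N * s 0 2 x) + r 3%N * s 3 0 x].
Proof.
have [_ [u [v [pu [pv [c0 s0]]]]]] := coamoeba_phases supp_f fx.
pose r i := Normc.normc (f (a i)) * (u ^ (a i).1 * v ^ (a i).2).
have nf0 i : (i < 4)%N -> 0 < Normc.normc (f (a i)).
  by move=> i4; rewrite normc_gt0// (coeff_neq0 supp_f).
have r0 i : (i < 4)%N -> 0 < r i.
  by move=> i4; rewrite /r !mulr_gt0 ?exprz_gt0// nf0.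
have row := cross_sum (al := al) (a := a) (r := r) c0 s0.
have ss i : s i i x = 0 by rewrite /sin_diff /phase_diff subrr sin0.
exists r; split => //; last 2 first.
- have := row 2%N; rewrite ss (sin_diffC al a 1 2) (sin_diffC al a 0 2).
  by rewrite !mulrN mulr0; move: (_ * _) (_ * _) (_ * _) => m0 m1 m2; lra.
- have := row 0%N; rewrite ss (sin_diffC al a 0 3).
  by rewrite !mulrN mulr0; move: (_ * _) (_ * _) (_ * _) => m0 m1 m2; lra.
rewrite /coeff_ratio /r.
have key (z : R) (u0 u1 u2 : int) : 0 < z -> (u1 - u0) * n%:Z = (u2 - u0) * p%:Z ->
    (z ^ u0) ^+ (n - p) * (z ^ u2) ^+ p = (z ^ u1) ^+ n.
  move=> z0 e; have zu : z \is a GRing.unit by rewrite unitfE gt_eqF.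
  rewrite !exprnP !exprz_exp -expfzDr ?gt_eqF//; congr (z ^ _).
  by rewrite -subzn ?(ltnW pn)//; lia.
rewrite !exprMn -(key _ _ _ _ pu col1) -(key _ _ _ _ pv col2).
by field; rewrite gt_eqF// exprn_gt0// nf0.
Qed.

Lemma prod_exp_lt (u u' v v' : R) : 0 <= u -> u < v -> 0 <= u' -> u' < v' ->
  u ^+ (n - p) * u' ^+ p < v ^+ (n - p) * v' ^+ p.
Proof.
move=> u0 uv u0' uv'.
have np : (0 < n - p)%N by rewrite subn_gt0.
by apply: ltr_pM; rewrite ?exprn_ge0// ltrXn2r// -?lt0n ?(ltnW pn).
Qed.

Lemma side_product_scale (r : R) :
  (r * `|s 1 2 x|) ^+ (n - p) * (r * `|s 0 1 x|) ^+ p = r ^+ n * side_product x.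
Proof. by rewrite !exprMn mulrACA -exprD subnK// ltnW. Qed.

Lemma middle_power_scale (r0 r1 r2 : R) : r0 ^+ (n - p) * r2 ^+ p = coeff_ratio * r1 ^+ n ->
  (r0 * `|s 0 2 x|) ^+ (n - p) * (r2 * `|s 0 2 x|) ^+ p = r1 ^+ n * middle_power x.
Proof.
move=> E; rewrite !exprMn mulrACA -exprD subnK ?(ltnW pn)// E /middle_power.
by rewrite mulrA [_ * coeff_ratio]mulrC.
Qed.

(** On [overlap] the [r 3] terms have the opposite sign and shrink both right sides of the sine
    relations. Multiplying the resulting inequalities with exponents [n - p] and [p] and cancelling
    [r 1 ^+ n] compares the two functions. *)
Lemma coamoeba_overlap_missed : ~~ overlap_missed x.
Proof.
have [r [r0 E e1 e2]] := coamoeba_moduli.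
have h0 := r0 0%N isT; have h1 := r0 1%N isT; have h2 := r0 2%N isT; have h3 := r0 3%N isT.
rewrite negb_and negbK; apply/orP; have [vx|] := boolP (overlap x); [right|by left].
have [lt1 lt2] : r 1%N * `|s 1 2 x| < r 0%N * `|s 0 2 x| /\ r 1%N * `|s 0 1 x| < r 2%N *
  `|s 0 2 x|.
  move: vx; rewrite /overlap /in_triangle (sin_diffC al a 0 2) oppr_gt0 oppr_lt0.
  case/andP=> /orP[] /and3P[w1 w2 w3] /orP[] /and3P[t1 t2 t3]; move: w3;
    rewrite ?(lt_gtF t1)// => w3.
    rewrite (gtr0_norm w1) (gtr0_norm w2) (ltr0_norm t1) e1 e2 !mulrN !gtrDl.
    by rewrite !pmulr_rlt0.
  rewrite (ltr0_norm w1) (ltr0_norm w2) (gtr0_norm t1) !mulrN e1 e2 !opprD !opprK !gtrDl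
    !oppr_lt0.
  by rewrite !pmulr_rgt0.
have := prod_exp_lt (mulr_ge0 (ltW h1) (normr_ge0 _)) lt1 (mulr_ge0 (ltW h1) (normr_ge0 _))
  lt2.
by rewrite side_product_scale (middle_power_scale E) ltr_pM2l// exprn_gt0.
Qed.

(** Here the [r 3] terms reinforce the others, which reverses both inequalities. *)
Lemma coamoeba_flip_missed : ~~ flip_missed x.
Proof.
have [r [r0 E e1 e2]] := coamoeba_moduli.
have h0 := r0 0%N isT; have h1 := r0 1%N isT; have h2 := r0 2%N isT; have h3 := r0 3%N isT.
rewrite negb_and negbK; apply/orP; have [vx|] := boolP (overlap_flip x); [right|by left].
have [lt1 lt2] : r 0%N * `|s 0 2 x| < r 1%N * `|s 1 2 x| /\ r 2%N * `|s 0 2 x| < r 1%N *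
  `|s 0 1 x|.
  move: vx; rewrite /overlap_flip /in_triangle (sin_diffC al a 0 2) oppr_gt0 oppr_lt0.
  case/andP=> /orP[] /and3P[w1 w2 w3] /orP[] /and3P[t1 t2 t3]; move: w3;
    rewrite ?(lt_gtF t1)// => w3.
    rewrite (gtr0_norm w1) (gtr0_norm w2) (ltr0_norm t1) e1 e2 !mulrN !ltrDl.
    by rewrite !pmulr_rgt0.
  rewrite (ltr0_norm w1) (ltr0_norm w2) (gtr0_norm t1) !mulrN e1 e2 !opprD !opprK !ltrDl
    !oppr_gt0.
  by rewrite !pmulr_rlt0.
have := prod_exp_lt (mulr_ge0 (ltW h0) (normr_ge0 _)) lt1 (mulr_ge0 (ltW h2) (normr_ge0 _))
  lt2.
by rewrite side_product_scale (middle_power_scale E) ltr_pM2l// exprn_gt0.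
Qed.
End Point.

Definition cover x := [&& two_triangles al a x, ~~ overlap_missed x & ~~ flip_missed x].

Lemma torus_fun_cover : torus_fun cover.
Proof.
apply: torus_fun_and; first exact: torus_fun_two_triangles.
apply: torus_fun_and; apply: torus_fun_neg; first exact: torus_fun_overlap_missed.
exact: torus_fun_flip_missed.
Qed.

(** Phase 3 lies in the sector between phases 0 and 2; the side of the line of phase 1 on which it
    falls decides which further triangle contains the origin. *)
Lemma overlap_flip_triangles x : generic x -> overlap_flip x ->
  [&& W x, ~~ tri 0 2 3 x & tri 0 1 3 x || tri 1 2 3 x].
Proof.
move=> /and5P[_ _ _ _ /andP[s13 _]] /andP[w]; rewrite w /=; move: w s13.
rewrite /in_triangle (sin_diffC al a 0 2) (sin_diffC al a 1 3) !oppr_gt0 !oppr_lt0.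
by case: (ltgtP 0 (s 0 1 x)) => //= _; case: (ltgtP 0 (s 1 2 x)) => //= _;
  case: (ltgtP 0 (s 0 2 x)) => //= _; case: (ltgtP 0 (s 1 3 x)) => //= _;
  case: (ltgtP 0 (s 2 3 x)) => //= _; case: (ltgtP 0 (s 3 0 x)) => //= _.
Qed.

(** By [E3], twice [cover] is at most [W] plus [3 * pi ^+ 2] minus twice the missed areas, which by
    [E1] total at least [overlap]. By [E2] this leaves at most [3 * pi ^+ 2] plus
    [triangle_outside]. *)
Lemma torus_area_cover : torus_area cover <= 2 * pi ^+ 2.
Proof.
have t0 : torus_fun (fun x => ~~ generic x) by apply: torus_fun_neg;
  exact: torus_fun_generic.
have mu0 := torus_area_nongeneric al inj_a.
have E1 : torus_area overlap + 0 <= torus_area overlap_missed + (torus_area overlap_rest +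
  0).
  have := @torus_area_count R [:: overlap] [:: overlap_missed; overlap_rest].
  rewrite !big_cons !big_nil; apply.
  - by move=> b [<-|//]; exact: torus_fun_overlap.
  - by move=> b [<-|[<-|//]];
    [exact: torus_fun_overlap_missed|exact: torus_fun_overlap_rest].
  - move=> x; rewrite !big_cons !big_nil /overlap_missed /overlap_rest;
    case: (overlap x) => //=.
    by case: ltgtP.
(* Within [W], phase 3 points opposite to the sector of phases 0 and 2, or into it, or its line
   misses the sector. *)
have E2 : torus_area W + 0 <= torus_area overlap + (torus_area overlap_flip + (torus_area
  triangle_outside + 0)).
  have := @torus_area_count_ae R _ [:: W] [:: overlap; overlap_flip;
    triangle_outside] t0 mu0.
  rewrite !big_cons !big_nil; apply.
  - by move=> b [<-|//]; exact: torus_fun_in_triangle.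
  - by move=> b [<-|[<-|[<-|//]]];
    [exact: torus_fun_overlap|exact: torus_fun_overlap_flip|exact:
    torus_fun_triangle_outside].
  - move=> x; rewrite !big_cons !big_nil negbK /overlap /overlap_flip /triangle_outside;
    case: (W x) => //=.
    rewrite /line_outside /generic /in_triangle (sin_diffC al a 0 3) oppr_gt0 oppr_lt0.
    case: (ltgtP 0 (s 0 2 x)) => //= h1; rewrite ?andbF//;
    case: (ltgtP 0 (s 0 3 x)) => //= h2; rewrite ?andbF//;
    case: (ltgtP 0 (s 2 3 x)) => //= h3; rewrite ?andbF//.
    1-4: first [by rewrite (mulr_gt0 h2 h3)|by rewrite (nmulr_rgt0 _ h2) h3].
(* At generic points the three regions on the left are disjoint and lie in at least two triangles,
   so each may be counted twice. *)
have E3 : torus_area cover + (torus_area cover + (torus_area overlap_missed + (torus_area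
  overlap_missed + (torus_area flip_missed + (torus_area flip_missed + 0))))) <=
   torus_area W + (torus_area (tri 0 1 3) + (torus_area (tri 0 2 3) + (torus_area (tri 1 2
     3) + 0))).
  have := @torus_area_count_ae R _ [:: cover; cover; overlap_missed; overlap_missed;
    flip_missed; flip_missed] [:: W; tri 0 1 3; tri 0 2 3; tri 1 2 3] t0 mu0.
  rewrite !big_cons !big_nil; apply.
  - move=> b /=; do 2![case=> [<-|]; first exact: torus_fun_cover].
    do 2![case=> [<-|]; first exact: torus_fun_overlap_missed].
    by do 2![case=> [<-|]; first exact: torus_fun_flip_missed].
  - by move=> b /=; do 4![case=> [<-|]; first exact: torus_fun_in_triangle].
  - move=> x; rewrite !big_cons !big_nil negbK /cover /two_triangles.
    move=> gx; have : overlap_missed x ==> W x && tri 0 2 3 x by apply/implyP => /andP[].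
    have : flip_missed x ==> [&& W x, ~~ tri 0 2 3 x & tri 0 1 3 x || tri 1 2 3 x].
      by apply/implyP => /andP[/(overlap_flip_triangles gx)].
    by case: (overlap_missed x); case: (flip_missed x); case: (W x); case: (tri 0 2 3 x);
      case: (tri 0 1 3 x); case: (tri 1 2 3 x).
move: (torus_area_in_triangle al d013) (torus_area_in_triangle al d023)
  (torus_area_in_triangle al d123) (torus_area_triangle_outside al p0 pn cop col1 col2
  d023).
move: E1 E2 E3; rewrite torus_area_overlap_flip torus_area_flip_missed.
move: (torus_area cover) (torus_area overlap) (torus_area overlap_missed) (torus_area
  overlap_rest) (torus_area W) (torus_area triangle_outside) (torus_area (tri 0 1 3))
  (torus_area (tri 0 2 3)) (torus_area (tri 1 2 3)).
move=> m1 m2 m3 m4 m5 m6 m7 m8 m9; lra.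
Qed.

Lemma area_collinear : (area (coamoeba f) <= (2 * pi ^+ 2)%:E)%E.
Proof.
have t0 : torus_fun (fun x => ~~ generic x) by apply: torus_fun_neg;
  exact: torus_fun_generic.
apply: le_trans (area_le_torus_area torus_fun_cover t0 (torus_area_nongeneric al inj_a)
  (coamoeba_square supp_f) _) _; last first.
  by rewrite lee_fin; exact: torus_area_cover.
move=> x fx; rewrite negbK => gx;
  rewrite /cover coamoeba_overlap_missed// coamoeba_flip_missed//.
by rewrite (coamoeba_two_triangles supp_f fx gx).
Qed.

End CollinearArea.

(** * Planar circuits *)

Section Points.
Implicit Types x y z w : int * int.

(** The ratio is kept in lowest terms because rotating the middle phase inverts [p] modulo [n]. *)
Definition between x y z : Prop := exists p n : nat,
  [/\ (0 < p)%N, (p < n)%N, coprime p n,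
      (y.1 - x.1) * n%:Z = (z.1 - x.1) * p%:Z & (y.2 - x.2) * n%:Z = (z.2 - x.2) * p%:Z].

(** Used over [rat] to order collinear points and over [R] to place points on a real line. *)
Lemma cross0_ratio (F : numFieldType) x y z : x != z -> cross x y z = 0 ->
  exists l : F, (y.1 - x.1)%:~R = l * (z.1 - x.1)%:~R /\ (y.2 - x.2)%:~R = l * (z.2 -
    x.2)%:~R.
Proof.
move=> xz; rewrite /cross => /eqP; rewrite subr_eq0 => /eqP.
move=> /(congr1 (fun k : int => k%:~R : F)); rewrite !rmorphM /= => e.
have [e1|d1] := eqVneq (z.1 - x.1) 0.
  have d2 : (z.2 - x.2)%:~R != 0 :> F.
    rewrite intr_eq0; apply: contra xz; rewrite !subr_eq0 => /eqP z2.
    by move/eqP: e1; rewrite subr_eq0 => /eqP z1; rewrite -pair_eqE /pair_eq /= z1 z2 !eqxx.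
  exists ((y.2 - x.2)%:~R / (z.2 - x.2)%:~R); rewrite divfK//; split => //.
  move: e; rewrite e1 mulr0 !mulr0z mulr0 => /eqP; rewrite mulf_eq0 (negPf d2) orbF => /eqP.
  by [].
have d1' : (z.1 - x.1)%:~R != 0 :> F by rewrite intr_eq0.
exists ((y.1 - x.1)%:~R / (z.1 - x.1)%:~R); rewrite divfK//; split => //.
by apply: (mulIf d1'); rewrite -e mulrAC divfK.
Qed.

Lemma between_ratio x y z (l : rat) : 0 < l < 1 ->
  (y.1 - x.1)%:~R = l * (z.1 - x.1)%:~R -> (y.2 - x.2)%:~R = l * (z.2 - x.2)%:~R ->
  between x y z.
Proof.
move=> /andP[l0 l1] e1 e2.
have nl : 0 < numq l by rewrite numq_gt0.
have dl : (denq l)%:~R != 0 :> rat by rewrite intr_eq0 denq_neq0.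
have lE : l * (denq l)%:~R = (numq l)%:~R by rewrite -[in X in X * _](divq_num_den l) divfK.
have nd : numq l < denq l.
  by rewrite -(ltr_int rat) -lE gtr_pMl// ltr0z denq_gt0.
exists `|numq l|%N, `|denq l|%N; split.
- by rewrite absz_gt0 gt_eqF.
- by rewrite -ltz_nat !gtz0_abs// denq_gt0.
- exact: coprime_num_den.
- apply: (intr_inj (R := rat)); rewrite !rmorphM /= !gtz0_abs ?denq_gt0//.
  by rewrite -lE e1; ring.
- apply: (intr_inj (R := rat)); rewrite !rmorphM /= !gtz0_abs ?denq_gt0//.
  by rewrite -lE e2; ring.
Qed.

(** The position of the ratio [l] relative to 0 and 1 tells which point is in the middle. *)
Lemma cross0_between x y z : x != y -> x != z -> y != z -> cross x y z = 0 ->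
  [\/ between x y z, between x z y | between y x z].
Proof.
move=> xy xz yz /(cross0_ratio rat xz)[l [e1 e2]].
have eqP2 u v : u != v -> (v.1 - u.1)%:~R = 0 :> rat -> (v.2 - u.2)%:~R = 0 :> rat -> False.
  move=> uv /eqP; rewrite intr_eq0 subr_eq0 => /eqP v1 /eqP.
  rewrite intr_eq0 subr_eq0 => /eqP v2.
  by move: uv; rewrite -pair_eqE /pair_eq /= v1 v2 !eqxx.
have l0 : l != 0.
  by apply/eqP => l0; apply: (eqP2 x y xy); rewrite ?e1 ?e2 l0 mul0r.
have l1 : l != 1.
  apply/eqP => l1; apply: (eqP2 y z yz).
    by move: e1; rewrite l1 mul1r => /intr_inj/addIr ->; rewrite subrr.
  by move: e2; rewrite l1 mul1r => /intr_inj/addIr ->; rewrite subrr.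
case: (ltgtP l 0) l0 => // l0 _; last case: (ltgtP l 1) l1 => // l1 _.
- have h : 1 - l != 0 by apply/eqP; lra.
  (* Exchanging the roles of [x] and [y] turns the ratio [l] into [- l / (1 - l)]. *)
  have E (u v t : int) : (v - u)%:~R = l * (t - u)%:~R ->
      (u - v)%:~R = - l / (1 - l) * (t - v)%:~R :> rat.
    rewrite !rmorphB /= => e; have -> : v%:~R = u%:~R + l * (t%:~R - u%:~R) :> rat.
      by rewrite -e; ring.
    by field.
  apply: Or33; apply: (between_ratio _ (E _ _ _ e1) (E _ _ _ e2)).
  have h' : 0 < 1 - l by lra.
  by rewrite divr_gt0 ?oppr_gt0//= ltr_pdivrMr//; lra.
- by apply: Or31; apply: between_ratio e1 e2; rewrite l0.
- apply: Or32; apply: (@between_ratio _ _ _ l^-1); rewrite ?e1 ?e2 ?mulKf ?gt_eqF//.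
  by rewrite invr_gt0 l0 invf_lt1.
Qed.

(** The determinant is affine in each point, and [y] is an affine combination of [x] and [z]. *)
Lemma between_crossE x y z w (p n : nat) :
  (y.1 - x.1) * n%:Z = (z.1 - x.1) * p%:Z -> (y.2 - x.2) * n%:Z = (z.2 - x.2) * p%:Z ->
  cross x y w * n%:Z = p%:Z * cross x z w /\
  cross y z w * n%:Z = (n%:Z - p%:Z) * cross x z w.
Proof.
move=> e1 e2; have E : cross x y w * n%:Z = p%:Z * cross x z w.
  by rewrite /cross mulrBl mulrAC e1 [X in _ - X]mulrAC e2; ring.
split=> //; transitivity (n%:Z * cross x z w - cross x y w * n%:Z
  - (z.1 - x.1) * ((y.2 - x.2) * n%:Z) + (z.2 - x.2) * ((y.1 - x.1) * n%:Z)).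
  by rewrite /cross; ring.
by rewrite E e1 e2; ring.
Qed.

Lemma between_cross x y z w : between x y z -> cross x z w = 0 ->
  cross x y w = 0 /\ cross y z w = 0.
Proof.
move=> [p [n [p0 pn _ h1 h2]]] e0; have [e1 e2] := between_crossE w h1 h2.
have n0 : n%:Z != 0 by apply/eqP; lia.
by split; apply: (mulIf n0); rewrite mul0r ?e1 ?e2 e0 mulr0.
Qed.

End Points.

(** * Reduction of a planar circuit to the two cases *)

Section CircuitArea.
Context {R : realType}.
Variable f : laurent2 R.
Implicit Types x y z w : int * int.

Lemma area_between x y z w : perm_eq (finsupp f) [:: x; y; z; w] ->
  between x y z -> cross x z w != 0 -> (area (coamoeba f) <= (2 * pi ^+ 2)%:E)%E.
Proof.
move=> pe [p [n [p0 pn cop e1 e2]]] d.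
pose a := nth (0, 0) [:: x; y; z; w].
have us : uniq [:: x; y; z; w] by rewrite -(perm_uniq pe) fset_uniq.
have inj i j : (i < j < 4)%N -> a i != a j.
  by move=> /andP[ij j4]; rewrite /a nth_uniq ?(ltn_trans ij j4)// ltn_eqF.
have n0 : n%:Z != 0 by apply/eqP; lia.
have [d1 d2] := between_crossE w e1 e2.
apply: (@area_collinear R f a p n) => //.
- apply/eqP => d0; move/eqP: d1; rewrite d0 mul0r eq_sym mulf_eq0 => /orP[/eqP|];
  first by lia.
  exact/negP.
- apply/eqP => d0; move/eqP: d2; rewrite d0 mul0r eq_sym mulf_eq0 => /orP[/eqP|];
  first by lia.
  exact/negP.
Qed.

Lemma cross_cycle x y z : cross y z x = cross x y z.
Proof. by rewrite /cross; ring. Qed.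

Lemma cross_swap x y z : cross y x z = - cross x y z.
Proof. by rewrite /cross; ring. Qed.

Lemma area_between_neq0 x y z w : perm_eq (finsupp f) [:: x; y; z; w] ->
  between x y z -> [|| cross x y w != 0, cross x z w != 0 | cross y z w != 0] ->
  (area (coamoeba f) <= (2 * pi ^+ 2)%:E)%E.
Proof.
move=> pe b nc; apply: (area_between pe b); apply: contraL nc => /eqP c0.
by have [-> ->] := between_cross b c0; rewrite c0 eqxx.
Qed.

Lemma area_three_collinear x y z w : perm_eq (finsupp f) [:: x; y; z; w] ->
  cross x y z = 0 ->
  [|| cross x y w != 0, cross x z w != 0 | cross y z w != 0] ->
  (area (coamoeba f) <= (2 * pi ^+ 2)%:E)%E.
Proof.
move=> pe c0 nc.
have : uniq [:: x; y; z; w] by rewrite -(perm_uniq pe) fset_uniq.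
rewrite /= !inE !negb_or => /and4P[/and3P[xy xz _] /andP[yz _] _ _].
have [b|b|b] := cross0_between xy xz yz c0.
- exact: area_between_neq0 pe b nc.
- apply: (@area_between_neq0 x z y w) => //.
    by apply: perm_trans pe _; apply/seq.permP => P /=; lia.
  by rewrite (cross_swap y z) oppr_eq0 orbCA.
- apply: (@area_between_neq0 y x z w) => //.
    by apply: perm_trans pe _; apply/seq.permP => P /=; lia.
  by rewrite (cross_swap x y) oppr_eq0 [(_ != 0) || (cross x z w != 0)]orbC.
Qed.

(** All differences of hull points lie in the line spanned by [y - x], so minimality of [V] bounds
    its dimension by 1. *)
Lemma conv_hull_line (A : {fset int * int}) x y : x != y ->
  (forall q, q \in A -> cross x y q = 0) -> ~ has_affine_dim (@conv_hull R A) 2.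
Proof.
move=> xy col [V [dV _ minV]].
pose W := <[@lattice_point R y - @lattice_point R x]>%VS.
have pW q : q \in A -> @lattice_point R q - @lattice_point R x \in W.
  move=> qA; have [|l [e1 e2]] := @cross0_ratio R x q y xy.
    by rewrite -[RHS]oppr0 -(col q qA) /cross; ring.
  apply/vlineP; exists l; apply/rowP => i; rewrite !mxE.
  by case: ifP => _; rewrite -!rmorphB.
have cW u : @conv_hull R A u -> u - @lattice_point R x \in W.
  move=> [w [w0 w1 ->]].
  rewrite -[X in _ - X]scale1r -w1 scaler_suml -sumrB.
  rewrite big_seq; apply: memv_suml => q qA.
  by rewrite -scalerBr; apply: memvZ; exact: pW.
have := dimvS (minV W _); rewrite dV dim_vline; case: (_ != 0) => /(_ _) H.
all: suff : forall u v, @conv_hull R A u -> @conv_hull R A v -> u - v \in W by move/H.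
all: move=> u v /cW uW /cW vW;
  rewrite (_ : u - v = (u - @lattice_point R x) - (v - @lattice_point R x)).
1,3: by apply: memvB.
all: by rewrite opprB addrA subrK.
Qed.

End CircuitArea.

Theorem theorem5p1 (R : realType) (A : {fset int * int}) (f : laurent2 R)
    (hA : planar_circuit R A) (hf : finsupp f = A) :
  (area (coamoeba f) <= (2 * pi ^+ 2)%:E)%E.
Proof.
have [sA dA] := hA.
have : size (finsupp f : seq _) = 4 by rewrite hf.
have : uniq (finsupp f) by exact: fset_uniq.
have mA q : (q \in A) = (q \in (finsupp f : seq _)) by rewrite hf.
have := perm_refl (finsupp f).
move: mA; case: {1 3 4 5}(finsupp f : seq _) => [|x [|y [|z [|w [|]]]]] // mA pe us _.
have := us; rewrite /= !inE !negb_or => /and4P[/and3P[xy xz _] _ _ _].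
pose a := nth (0, 0) [:: x; y; z; w].
have [c1|c1] := eqVneq (cross x y z) 0.
  apply: (area_three_collinear pe c1); apply: contraT.
  (* If [w] were collinear with [x] and [y], all of [A] would lie on one line. *)
  rewrite !negb_or !negbK => /and3P[/eqP c2 _ _]; exfalso.
  apply: (conv_hull_line xy) dA => q; rewrite mA !inE => /or4P[] /eqP-> //;
    rewrite /cross; ring.
(* From here on [c1] shows that the point outside each collinear triple is off its line. *)
have [c2|c2] := eqVneq (cross x y w) 0.
  apply: (@area_three_collinear R f x y w z) => //; last by rewrite c1.
  by apply: perm_trans pe _; apply/seq.permP => P /=; lia.
have [c3|c3] := eqVneq (cross x z w) 0.
  apply: (@area_three_collinear R f x z w y) => //.
    by apply: perm_trans pe _; apply/seq.permP => P /=; lia.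
  by rewrite -cross_cycle cross_swap cross_cycle oppr_eq0 c1.
have [c4|c4] := eqVneq (cross y z w) 0.
  apply: (@area_three_collinear R f y z w x) => //.
    by apply: perm_trans pe _; apply/seq.permP => P /=; lia.
  by rewrite cross_cycle c1.
apply: (@area_noncollinear R f a) => // i j /andP[ij j4].
by rewrite /a nth_uniq ?(ltn_trans ij j4)// ltn_eqF.
Qed.
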